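(* Assume that for every integer $n\ge2$ and every real transcendental number $\zeta$ we have $\widehat w_n(\zeta)\le\phi_n(w_n(\zeta))$. Let $\tau\approx0.5693$ be the unique solution $y\in(0,1)$ of $y\,e^{1/y}=2\sqrt e$, and put $\Delta:=\log(2/\tau)+1\approx2.2564$. Then the following hold. (i) For every $\epsilon>0$ there exists $n_0=n_0(\epsilon)$ such that for all real transcendental $\zeta$ and all $n\ge n_0$ $$\widehat w_n^{*}(\zeta)\le 2n-\Delta+\epsilon.$$ (ii) Under the same quantifiers, $\widehat w_n(\zeta)\le 2n-\Delta+\epsilon$ holds as well, unless $w_{n-2}(\zeta)<w_{n-1}(\zeta)=w_n(\zeta)$. (iii) For all real transcendental $\zeta$ and all $n\ge10$, we have $\widehat w_n(\zeta)\le 2n-2$.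
   Context: Let $\zeta$ be real and $n\ge1$. For a polynomial $P\in\mathbb Z[X]$, $H(P)$ denotes its height, the maximum absolute value of its coefficients. - $w_n(\zeta)$ is the supremum of $\nu$ such that $|P(\zeta)|\le X^{-\nu}$ has a solution in nonzero $P\in\mathbb Z[X]$ with $\deg P\le n$ and $H(P)\le X$, for arbitrarily large $X$. - $\widehat w_n(\zeta)$ is the analogous supremum where a solution is required for all sufficiently large $X$. - For a real algebraic number $\alpha$, $H(\alpha)$ is the height of its irreducible minimal polynomial over $\mathbb Z$. - $\widehat w_n^{*}(\zeta)$ is the supremum of $\nu$ such that for all large $X$ there is a real algebraic $\alpha$ of degree at most $n$ with $H(\alpha)\le X$ and $0<|\zeta-\alpha|\le H(\alpha)^{-1}X^{-\nu}$. The function $\phi_n:[n,\infty]\to[n,\infty]$ (the relation between $\widehat w_n$ and $w_n$ in the Schmidt–Summerer regular graph) is defined as follows: - $\phi_n(n)=n$ and $\phi_n(\infty)=\infty$; - for $w\in(n,\infty)$, $\phi_n(w)$ is the unique solution $y\in[n,w)$ of $w-y+1=(w/y)^n$. $\phi_n$ is increasing. The hypothesis is the Schmidt–Summerer conjecture for successive powers. *)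

(* Defs.v *)
From Stdlib Require Import Reals Lra Lia ZArith.
Open Scope R_scope.

Inductive ER : Type := ENInf | EFin (r : R) | EPInf.

Definition ER_le (a b : ER) : Prop :=
  match a, b with
  | ENInf, _ => True
  | _, EPInf => True
  | EFin x, EFin y => x <= y
  | _, _ => False
  end.

Definition ER_lt (a b : ER) : Prop := ER_le a b /\ a <> b.

Definition is_ER_sup (S : R -> Prop) (e : ER) : Prop :=
  (forall x, S x -> ER_le (EFin x) e) /\
  (forall e', (forall x, S x -> ER_le (EFin x) e') -> ER_le e e').

(** Integer polynomials of degree <= n are given by coefficient functions
    [c : nat -> Z], only the coefficients [c 0 .. c n] being used. *)
Definition peval (n : nat) (c : nat -> Z) (x : R) : R :=
  sum_f_R0 (fun k => IZR (c k) * x ^ k) n.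

Fixpoint pheight (n : nat) (c : nat -> Z) : Z :=
  match n with
  | O => Z.abs (c O)
  | S m => Z.max (pheight m c) (Z.abs (c (S m)))
  end.

Definition pnonzero (n : nat) (c : nat -> Z) : Prop :=
  exists k, (k <= n)%nat /\ c k <> 0%Z.

Definition transcendental (z : R) : Prop :=
  forall n c, pnonzero n c -> peval n c z <> 0.

Definition w_set (n : nat) (z : R) (nu : R) : Prop :=
  forall X0 : R, exists X : R, X0 <= X /\ 1 <= X /\
    exists c, pnonzero n c /\ IZR (pheight n c) <= X /\
      Rabs (peval n c z) <= Rpower X (- nu).

Definition what_set (n : nat) (z : R) (nu : R) : Prop :=
  exists X0 : R, 1 <= X0 /\ forall X : R, X0 <= X ->
    exists c, pnonzero n c /\ IZR (pheight n c) <= X /\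
      Rabs (peval n c z) <= Rpower X (- nu).

Definition primitive (d : nat) (c : nat -> Z) : Prop :=
  forall g : Z, (forall k, (k <= d)%nat -> Z.divide g (c k)) -> Z.abs g = 1%Z.

(** [alpha] is a real algebraic number of degree [d] whose (irreducible,
    primitive) minimal polynomial over Z has height [h]: the minimal
    polynomial is the primitive integer polynomial of least degree
    vanishing at alpha. *)
Definition alg_deg_height (alpha : R) (d : nat) (h : R) : Prop :=
  exists c : nat -> Z,
    c d <> 0%Z /\ (forall k, (d < k)%nat -> c k = 0%Z) /\
    peval d c alpha = 0 /\ primitive d c /\
    (forall d' c', (d' < d)%nat -> pnonzero d' c' -> peval d' c' alpha <> 0) /\
    h = IZR (pheight d c).

Definition whatstar_set (n : nat) (z : R) (nu : R) : Prop :=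
  exists X0 : R, 1 <= X0 /\ forall X : R, X0 <= X ->
    exists (alpha : R) (d : nat) (h : R),
      (1 <= d <= n)%nat /\ alg_deg_height alpha d h /\ h <= X /\
      0 < Rabs (z - alpha) /\ Rabs (z - alpha) <= / h * Rpower X (- nu).

Definition w_ (n : nat) (z : R) (e : ER) : Prop := is_ER_sup (w_set n z) e.
Definition what_ (n : nat) (z : R) (e : ER) : Prop := is_ER_sup (what_set n z) e.
Definition whatstar_ (n : nat) (z : R) (e : ER) : Prop :=
  is_ER_sup (whatstar_set n z) e.

Definition phi_rel (n : nat) (a y : ER) : Prop :=
  (a = EFin (INR n) /\ y = EFin (INR n)) \/
  (a = EPInf /\ y = EPInf) \/
  (exists w v, a = EFin w /\ y = EFin v /\ INR n < w /\
     INR n <= v < w /\ w - v + 1 = (w / v) ^ n).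

Definition SS_conj (n : nat) (z : R) : Prop :=
  forall a b y, w_ n z a -> what_ n z b -> phi_rel n a y -> ER_le b y.

(* Main.v *)
Require Import Defs.
From Stdlib Require Import Reals Lra Lia ZArith List Classical.
From mathcomp Require all_boot all_order perm all_algebra Rstruct ssrZ zify.
Open Scope R_scope.

(** Let [w = w_n] and [w^ = ^w_n].  If [w^ > T], the Schmidt-Summerer inequality
    forces [w > W], where [phi_n W >= T].  Let [m <= n] be a degree at which the
    exponent [w_m] jumps above [W].  Since heights are multiplicative up to
    constants, the good approximations [q] of degree [m] are irreducible, and any
    [p] of degree at most [n] not divisible by [q] satisfies

      1 <= |Res(p,q)| << H(p)^m H(q)^n (|p(z)| / H(p) + |q(z)| / H(q)).

    If [m = n], or if [p] is irreducible (as for the starred exponent), taking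
    [|p(z)| < |q(z)|] excludes [q | p], and the inequality yields
    [w^ <= n w / (w - n + 1)].  In general, taking [H(p) < c H(q)] excludes
    [q | p] and yields [w^ <= m + n - 1].  The first bound decreases in [w] while
    [phi_n] increases: for [T = 2 n - s] and [W = T (n - 1) / (T - n)], the
    requirement [W - T + 1 >= (W / T)^n] tends to [2 s - 1 >= e^(s - 1)] as
    [n -> oo], whose equality case is [s = Delta]; for [s = 2] it holds from
    [n = 10] on. *)

(* ssrnat rebinds [<=] on [nat]; importing it inside modules keeps the final
   statement in terms of [le]. *)
Module IntPoly.
Import all_boot all_order perm all_algebra Rstruct ssrZ zify.
Import Order.TTheory GRing.Theory Num.Theory.
Set Implicit Arguments.
Unset Strict Implicit.
Local Open Scope ring_scope.
Implicit Types p q : {poly int}.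

(** * Heights of integer polynomials and their near multiplicativity *)

Definition height (p : {poly int}) : nat := (\max_(i < size p) `|(p`_i)%R|)%N.

Lemma coef_le_height p i : (`|(p`_i)%R| <= height p)%N.
Proof.
case: (ltnP i (size p)) => [lt_ip | le_pi]; last by rewrite nth_default.
exact: (@leq_bigmax _ (fun j : 'I_(size p) => `|(p`_j)%R|%N) (Ordinal lt_ip)).
Qed.

Lemma height_leP p h : reflect (forall i, (`|(p`_i)%R| <= h)%N) (height p <= h)%N.
Proof.
apply: (iffP idP) => [le_ph i | le_ph]; first exact: leq_trans (coef_le_height p i) le_ph.
by apply/bigmax_leqP => i _.
Qed.

Lemma height_gt0 p : (0 < height p)%N = (p != 0).
Proof.
apply/idP/idP => [|p0]; last first.
  apply: leq_trans (coef_le_height p (size p).-1).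
  by rewrite -lead_coefE absz_gt0 lead_coef_eq0.
by apply: contraTneq => ->; rewrite /height size_poly0 big_ord0.
Qed.

Lemma absz_horner_le p (x h : nat) (n : nat) :
  (size p <= n.+1)%N -> (height p <= h)%N ->
  (`|p.[x%:Z]| <= n.+1 * (h * x.+1 ^ n))%N.
Proof.
move=> sp hp; rewrite (horner_coef_wide _ sp).
have abs_sum m (f : 'I_m -> int) : (`|(\sum_i f i)%R| <= \sum_i `|f i|)%N.
  elim/big_ind2: _ => // a b c d le1 le2.
  by apply: leq_trans (leq_add le1 le2); lia.
apply: leq_trans (abs_sum _ _) _.
have -> : (n.+1 * (h * x.+1 ^ n) = \sum_(i < n.+1) (h * x.+1 ^ n))%N.
  by rewrite sum_nat_const card_ord.
apply: leq_sum => i _; rewrite abszM leq_mul //.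
  exact: leq_trans (coef_le_height _ _) hp.
rewrite abszX absz_nat; apply: (@leq_trans (x.+1 ^ i)%N).
  by case: {+}(i : nat) => // e; rewrite leq_exp2r.
by rewrite leq_pexp2l // -ltnS.
Qed.

(* Newton interpolation: dividing [p - p.[x]] by ['X - x] lowers the number of
   nodes by one, and keeps integer values at the remaining nodes since two
   nodes are at distance at least 1. *)
Lemma height_interpolation (N a : nat) : exists2 C : nat, (0 < C)%N &
  forall (p : {poly int}) (s : seq nat) (M : nat), (size p <= a)%N -> uniq s ->
    all (fun x => x <= N)%N s -> size s = a ->
    (forall x : nat, x \in s -> (`|p.[x%:Z]| <= M)%N) -> (height p <= C * M)%N.
Proof.
elim: a => [|a [C C0 IH]].
  exists 1%N => // p s M sp _ _ _ _.
  by move: sp; rewrite leqn0 size_poly_eq0 => /eqP ->; rewrite /height size_poly0 big_ord0.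
exists (N.+1 * (C * 2) + 1)%N; first by rewrite addn1.
move=> p [|x0 s] M // sp /= /andP[x0s us] /andP[x0N sN] [ss] pM.
have /factor_theorem[q Eq] : root (p - p.[x0%:Z]%:P) x0%:Z.
  by rewrite /root !hornerE subrr.
have Ep : p = q * ('X - x0%:Z%:P) + p.[x0%:Z]%:P by rewrite -Eq subrK.
have sq : (size q <= a)%N.
  have [-> | q0] := eqVneq q 0; first by rewrite size_poly0.
  rewrite -ltnS.
  have <- : size (q * ('X - x0%:Z%:P)) = (size q).+1.
    by rewrite size_Mmonic ?monicXsubC // size_XsubC addn2.
  rewrite -Eq (leq_trans (size_polyD _ _)) // geq_max sp size_polyN size_polyC.
  by case: (_ != 0).
have hq : (height q <= C * (2 * M))%N.
  apply: (IH q s) => // x xs.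
  have Ex : q.[x%:Z] * (x%:Z - x0%:Z) = p.[x%:Z] - p.[x0%:Z].
    by have := congr1 (fun r => r.[x%:Z]) Eq; rewrite !hornerE => ->.
  have nx : x != x0 by apply: contraNneq x0s => <-.
  have px := pM x _; have px0 := pM x0 _.
  move: px px0; rewrite !inE eqxx xs orbT => /(_ isT) px /(_ isT) px0.
  have : (`|q.[x%:Z]| * 1 <= `|q.[x%:Z]| * `|(x%:Z - x0%:Z)%R|)%N.
    by rewrite leq_mul2l; apply/orP; right; lia.
  rewrite -abszM Ex; move: px px0; clear.
  move: (p.[_]) (p.[_]) (q.[_]) => u v w; rewrite muln1.
  lia.
apply/height_leP => i; rewrite Ep coefD coefC mulrBr coefB coefMX coefMC.
have px0 : (`|p.[x0%:Z]| <= M)%N by apply: pM; rewrite inE eqxx.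
have h1 : (`|(if i == 0%N then 0 else q`_i.-1)%R| <= C * (2 * M))%N.
  by case: ifP => // _; apply: leq_trans (coef_le_height _ _) hq.
have h2 : (`|(q`_i * x0%:Z)%R| <= C * (2 * M) * N)%N.
  by rewrite abszM leq_mul //; apply: leq_trans (coef_le_height _ _) hq.
have h3 : (`|(if i == 0%N then p.[x0%:Z] else 0)%R| <= M)%N by case: ifP.
have bound (u v w : int) : (`|u| <= C * (2 * M) -> `|v| <= C * (2 * M) * N -> `|w| <= M ->
    `|(u - v + w)%R| <= (N.+1 * (C * 2) + 1) * M)%N.
  move=> hu hv hw.
  have tri : (`|(u - v + w)%R| <= `|u| + `|v| + `|w|)%N by clear; lia.
  have -> : ((N.+1 * (C * 2) + 1) * M = C * (2 * M) + C * (2 * M) * N + M)%N by clear; lia.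
  by apply: leq_trans tri _; rewrite !leq_add.
exact: bound.
Qed.

(** A form of Gelfond's inequality. By interpolation, a nonzero polynomial of degree at most [n] is
    small against its height at no more than [n] integer nodes. Hence among [2n + 1] nodes one is
    good for both factors, and there the product of the two values is controlled by the height of
    [p * q]. *)
Lemma height_mul_le (n : nat) : exists2 K : nat, (0 < K)%N &
  forall p q : {poly int}, p != 0 -> q != 0 -> (size (p * q)%R <= n.+1)%N ->
    (height p * height q <= K * height (p * q)%R)%N.
Proof.
have [C C0 HC] := height_interpolation n.*2 n.+1.
exists (C * C * (n.+1 * n.*2.+1 ^ n))%N; first by rewrite !muln_gt0 C0 expn_gt0.
have few_bad p : p != 0 -> (size p <= n.+1)%N ->
    (count (fun x : nat => C * `|p.[x%:Z]| < height p)%N (iota 0 n.*2.+1) <= n)%N.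
  move=> p0 sp; rewrite leqNgt; apply/negP => big.
  (* At a bad node the value is at most [(height p).-1 %/ C], so interpolating at [n.+1] bad nodes
     would give [height p <= (height p).-1]. *)
  have := HC p (take n.+1 [seq x <- iota 0 n.*2.+1 | (C * `|p.[x%:Z]| < height p)%N])
    ((height p).-1 %/ C)%N sp.
  have H : forall x, x \in take n.+1 [seq x <- iota 0 n.*2.+1 | (C * `|p.[x%:Z]| < height p)%N] ->
     (x <= n.*2)%N /\ (C * `|p.[x%:Z]| < height p)%N.
    by move=> x /mem_take; rewrite mem_filter mem_iota => /andP[-> ]; split => //; lia.
  rewrite take_uniq ?filter_uniq ?iota_uniq // => /(_ isT).
  have -> : all (fun x => x <= n.*2)%N
      (take n.+1 [seq x <- iota 0 n.*2.+1 | (C * `|p.[x%:Z]| < height p)%N]).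
    by apply/allP => x /H[].
  rewrite size_take size_filter => /(_ isT).
  have -> : (if (n.+1 < count (fun x : nat => C * `|p.[x%:Z]| < height p) (iota 0 n.*2.+1))%N
     then n.+1 else count (fun x : nat => C * `|p.[x%:Z]| < height p)%N (iota 0 n.*2.+1)) = n.+1.
    case: ifP => //; lia.
  have hp : (0 < height p)%N by rewrite height_gt0.
  move=> /(_ erefl) H2; suff : (height p <= (height p).-1)%N by lia.
  have h3 := leq_trunc_div (height p).-1 C.
  apply: leq_trans h3; rewrite mulnC; apply: H2 => x /H[_ hx].
  by rewrite leq_divRL //; lia.
move=> p q p0 q0 spq.
have sp : (size p <= n.+1)%N.
  apply: leq_trans spq; rewrite size_mul //; move: q0; rewrite -size_poly_gt0.
  by case: (size q) => // b _; rewrite addnS leq_addr.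
have sq : (size q <= n.+1)%N.
  apply: leq_trans spq; rewrite size_mul //; move: p0; rewrite -size_poly_gt0.
  by case: (size p) => // b _; rewrite addSn leq_addl.
have := few_bad p p0 sp; have := few_bad q q0 sq.
set bp := fun x : nat => (C * `|p.[x%:Z]| < height p)%N.
set bq := fun x : nat => (C * `|q.[x%:Z]| < height q)%N => cq cp.
(* The two bad sets have at most [2n] nodes together, one fewer than available. *)
have /allPn[x] : ~~ all (predU bp bq) (iota 0 n.*2.+1).
  rewrite all_count size_iota.
  have := count_predUI bp bq (iota 0 n.*2.+1); lia.
rewrite mem_iota /= negb_or -!leqNgt => xn /andP[hp hq].
apply: leq_trans (leq_mul hp hq) _.
have := @absz_horner_le (p * q) x _ n spq (leqnn _).
rewrite hornerM abszM => H.
have -> : (C * `|p.[x%:Z]| * (C * `|q.[x%:Z]|) = C * C * (`|p.[x%:Z]| * `|q.[x%:Z]|))%N by lia.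
rewrite -!mulnA leq_mul2l; apply/orP; right; rewrite leq_mul2l; apply/orP; right.
apply: leq_trans H _; rewrite leq_mul2l; apply/orP; right.
rewrite mulnC leq_mul2r; apply/orP; right.
by case: (n in (_ ^ n)%N) xn => // e xn; rewrite leq_exp2r //; lia.
Qed.

(** * Lower bound for the resultant through the Sylvester matrix *)

Lemma det_norm_le (F : realFieldType) (n : nat) (A : 'M[F]_n) (r : 'I_n -> F) :
  (forall i j, `|A i j| <= r i) -> `|\det A| <= n`!%:R * \prod_i r i.
Proof.
move=> Ar; rewrite /determinant (le_trans (ler_norm_sum _ _ _)) //.
apply: (@le_trans _ _ (\sum_(s : 'S_n) \prod_i r i)); last first.
  by rewrite sumr_const card_Sn mulr_natl.
apply: ler_sum => s _; rewrite normrM normr_sign mul1r normr_prod.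
by apply: ler_prod => i _; rewrite normr_ge0 Ar.
Qed.

(** The minor omits row [i0]; multiplying back by [r i0] restores the full product without dividing
    by a row bound. *)
Lemma cofactor_norm_le (F : realFieldType) (n : nat) (A : 'M[F]_n) (r : 'I_n -> F) i0 j0 :
  (forall i j, `|A i j| <= r i) -> (forall i, 0 <= r i) ->
  `|cofactor A i0 j0| * r i0 <= n`!%:R * \prod_i r i.
Proof.
move=> Ar r0; rewrite /cofactor normrM normrX normrN1 expr1n mul1r.
rewrite [X in _ <= _ * X](bigD1_ord i0) //= mulrCA [X in X <= _]mulrC ler_wpM2l //.
apply: le_trans (@det_norm_le _ _ _ (fun k => r (lift i0 k)) _) _.
  by move=> i j; rewrite !mxE.
rewrite ler_wpM2r ?prodr_ge0 // ler_nat.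
by case: (n) => // m; rewrite factS leq_pmull.
Qed.

Definition ev (F : realFieldType) p (z : F) : F := (map_poly intr p).[z].

(** The rows of the Sylvester matrix are the coefficient vectors of the shifts of [p] and [q] by
    powers of the variable, so the column of powers of [z] evaluates these shifts. *)
Lemma mulmx_Sylvester_powers (F : realFieldType) p q (z : F) i :
  p != 0 -> q != 0 ->
  (map_mx intr (Sylvester_mx p q) *m \col_j z ^+ j) i 0 =
    match split i with inl k => ev p z * z ^+ k | inr k => ev q z * z ^+ k end.
Proof.
move=> p0 q0.
have shift (N k : nat) (r : {poly int}) : (k + size r <= N)%N -> r != 0 ->
    \sum_(j < N) (r`_(j - k) *+ (k <= j)%N)%:~R * z ^+ j = ev r z * z ^+ k.
  move=> le_N r0.
  have -> : ev r z * z ^+ k = (map_poly intr ('X^k * r)).[z].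
    by rewrite rmorphM /= map_polyXn hornerM hornerXn mulrC.
  rewrite (@horner_coef_wide _ N); last first.
    by rewrite (leq_trans (size_poly _ _)) // mulrC size_mulXn.
  apply: eq_bigr => j _; rewrite coef_map coefXnM ltnNge.
  by case: leqP; rewrite ?mulr1n.
rewrite mxE; under eq_bigr => j _ do rewrite [map_mx _ _ _ _]mxE [(\col__ _) _ _]mxE Sylvester_mxE.
have pP : (0 < size p)%N by rewrite size_poly_gt0.
have qP : (0 < size q)%N by rewrite size_poly_gt0.
case: (split i) => k; apply: shift => //.
  rewrite -{1}(prednK pP) addnS -addSn leq_add2r; exact: ltn_ord.
rewrite -{1}(prednK qP) addnS -addSn addnC leq_add2l; exact: ltn_ord.
Qed.

(** The resultant is a nonzero integer, and the adjugate writes it as a combination of the values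
    [ev p z * z ^+ k] and [ev q z * z ^+ k] with cofactors as coefficients. Each cofactor misses one
    row, hence one factor [X] or [Y]: this is the source of the quotients in the last parenthesis.
    Leaving [X] and [Y] free above the heights lets [X] be tuned later. *)
Lemma resultant_ge1 (F : realFieldType) (z X Y : F) p q (n m : nat) :
  p != 0 -> resultant p q != 0 -> (size p <= n.+1)%N -> (size q <= m.+1)%N ->
  (1 < size q)%N -> 1 <= X -> 1 <= Y ->
  (height p)%:R <= X -> (height q)%:R <= Y ->
  1 <= (n + m)%:R * (n + m)`!%:R * (1 + `|z|) ^+ (n + m) *
       (X ^+ m * Y ^+ n) * (`|ev p z| / X + `|ev q z| / Y).
Proof.
move=> p0 res0 sp sq q1 X1 Y1 hp hq.
have q0 : q != 0 by rewrite -size_poly_gt0 (ltn_trans _ q1).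
have X0 : 0 < X := lt_le_trans ltr01 X1.
have Y0 : 0 < Y := lt_le_trans ltr01 Y1.
set N := ((size q).-1 + (size p).-1)%N.
have N0 : (0 < N)%N by rewrite /N; case: (size q) q1 => [|[]].
have leN : (N <= n + m)%N.
  by rewrite /N addnC leq_add // -ltnS prednK // size_poly_gt0.
pose M : 'M[F]_N := map_mx intr (Sylvester_mx p q).
pose v : 'cV[F]_N := \col_j z ^+ j.
pose r (i : 'I_N) : F := match split i with inl _ => X | inr _ => Y end.
pose S := `|ev p z| / X + `|ev q z| / Y.
have r0 i : 0 < r i by rewrite /r; case: split.
have r1 i : 1 <= r i by rewrite /r; case: split.
have S0 : 0 <= S by rewrite addr_ge0 // divr_ge0 // ltW.
have coef_le (t : {poly int}) i T : (height t)%:R <= T -> `|(t`_i)%:~R : F| <= T.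
  move=> ht; apply: le_trans ht; rewrite -intr_norm -abszE -natr_absz ler_nat.
  exact: coef_le_height.
have Mr i j : `|M i j| <= r i.
  rewrite mxE Sylvester_mxE /r; case: (split i) => k; case: (k <= j)%N;
    by rewrite ?mulr1n ?mulr0n ?normr0 ?coef_le // ltW.
have prodr : \prod_i r i = X ^+ (size q).-1 * Y ^+ (size p).-1.
  rewrite big_split_ord /=; congr (_ * _).
    transitivity (\prod_(k < (size q).-1) X); last by rewrite prodr_const card_ord.
    apply: eq_bigr => k _.
    by rewrite /r (unsplitK (inl k : 'I__ + 'I__)).
  transitivity (\prod_(k < (size p).-1) Y); last by rewrite prodr_const card_ord.
  apply: eq_bigr => k _.
  by rewrite /r (unsplitK (inr k : 'I__ + 'I__)).
have detE : (\det M)%:M *m v = \adj M *m (M *m v) by rewrite mulmxA mul_adj_mx.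
(* The first coordinate of [v] is [z ^+ 0 = 1], so this coordinate of the identity isolates the
   determinant. *)
have := congr1 (fun A : 'cV[F]_N => A (Ordinal N0) 0) detE.
rewrite mul_scalar_mx !mxE expr0 mulr1 => detE0.
have det1 : 1 <= `|\det M|.
  rewrite /M det_map_mx -/(resultant p q) -intr_norm -abszE -natr_absz ler1n.
  by rewrite absz_gt0.
apply: (le_trans det1); rewrite detE0 (le_trans (ler_norm_sum _ _ _)) //.
set B := N`!%:R * (X ^+ m * Y ^+ n) * (1 + `|z|) ^+ N * S.
have Z1 : 1 <= 1 + `|z| by rewrite lerDl.
have termB (i : 'I_N) : `|(\adj M) (Ordinal N0) i * (M *m v) i 0| <= B.
  rewrite mxE normrM mulmx_Sylvester_powers //.
  have cof := cofactor_norm_le i (Ordinal N0) Mr (fun k => ltW (r0 k)).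
  (* [|ev p z| <= X * S] and [|ev q z| <= Y * S]; the factor [r i] gained here is the one that the
     cofactor lacks. *)
  have Mv : `|match split i with inl k => ev p z * z ^+ k | inr k => ev q z * z ^+ k end|
     <= r i * ((1 + `|z|) ^+ N * S).
    have pw k : (k < N)%N -> `|z ^+ k| <= (1 + `|z|) ^+ N.
      move=> kN; rewrite normrX (@le_trans _ _ ((1 + `|z|) ^+ k)) //.
        by rewrite lerXn2r ?nnegrE ?addr_ge0 // lerDr.
      by rewrite ler_weXn2l // ltnW.
    rewrite /r; case: (split i) => k; rewrite normrM [_ * S]mulrC mulrA.
      apply: ler_pM => //; last exact/pw/ltn_addr.
      by rewrite /S mulrDr mulrCA divff ?gt_eqF // mulr1 lerDl mulr_ge0 ?divr_ge0 // ltW.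
    apply: ler_pM => //; last exact/pw/ltn_addl.
    rewrite /S mulrDr [X in _ <= _ + X]mulrCA divff ?gt_eqF // mulr1 lerDr.
    by rewrite mulr_ge0 ?divr_ge0 // ltW.
  apply: le_trans (ler_wpM2l (normr_ge0 _) Mv) _.
  rewrite mulrA /B -[X in _ <= X]mulrA ler_wpM2r //.
    by rewrite mulr_ge0 // exprn_ge0 // (le_trans ler01).
  apply: le_trans cof _; rewrite prodr ler_wpM2l // ler_pM ?exprn_ge0 ?(ltW X0) ?(ltW Y0) //.
    by rewrite ler_weXn2l // -ltnS prednK // ltnW.
  by rewrite ler_weXn2l // -ltnS prednK // size_poly_gt0.
apply: (@le_trans _ _ (\sum_(i < N) B)).
  by apply: ler_sum => i _; have := termB i; rewrite !mxE.
have Z0 := le_trans ler01 Z1.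
rewrite sumr_const card_ord -[X in X <= _]mulr_natl /B [N`!%:R * _ * _]mulrAC -/S.
rewrite !mulrA; do 3! rewrite ler_wpM2r ?exprn_ge0 ?(ltW X0) ?(ltW Y0) //.
do 2! rewrite ler_pM ?mulr_ge0 ?exprn_ge0 // ?ler_nat ?ler_weXn2l //.
exact: leq_fact.
Qed.

End IntPoly.

(** * Integer polynomials evaluated at a real number *)

Module RealEval.
Import all_boot all_order perm all_algebra Rstruct ssrZ zify.
Import Order.TTheory GRing.Theory Num.Theory.
Import IntPoly.
Local Open Scope ring_scope.
Local Open Scope R_scope.

Definition ipoly : Type := {poly int}.
Implicit Types p q r : {poly int}.

Definition evalR p (z : R) : R := ev p z.
Definition ht p : R := INR (height p).
Definition nonzero p : Prop := p <> 0%R.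
Definition deg_le (n : nat) p : Prop := le (size p) (S n).
Definition has_degree (n : nat) p : Prop := size p = S n.
Definition pmul p q : {poly int} := (p * q)%R.

(** For a nonconstant [q] this is irreducibility in Z[X], with the sign normalized:
    [zprimitive q = q] means content 1 and positive leading coefficient. *)
Definition indecomposable q : Prop :=
  ~ deg_le 0 q /\ zprimitive q = q /\
  forall a b, q = pmul a b -> deg_le 0 a \/ deg_le 0 b.

Lemma evalR_mul p q z : evalR (pmul p q) z = evalR p z * evalR q z.
Proof. by rewrite /evalR /ev /pmul rmorphM hornerM. Qed.

Lemma nonzero_mul p q : nonzero (pmul p q) -> nonzero p /\ nonzero q.
Proof. by move=> pq; split=> E; apply: pq; rewrite /pmul E ?mul0r ?mulr0. Qed.

Lemma ht_ge1 p : nonzero p -> 1 <= ht p.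
Proof.
move=> /eqP p0; rewrite /ht -[1]/(INR 1); apply: le_INR; apply/ssrnat.leP.
by rewrite height_gt0.
Qed.

Lemma ht_mul_le n : exists K : R, 1 <= K /\ forall p q, nonzero (pmul p q) ->
  deg_le n (pmul p q) -> ht p * ht q <= K * ht (pmul p q).
Proof.
have [K K0 HK] := height_mul_le n; exists (INR K); split.
  by rewrite -[1]/(INR 1); apply: le_INR; apply/ssrnat.leP.
move=> p q /nonzero_mul[/eqP p0 /eqP q0] /ssrnat.leP spq.
by rewrite /ht -!mult_INR; apply: le_INR; apply/ssrnat.leP; exact: HK.
Qed.

Lemma resultant_bound n m z : exists C : R, 0 < C /\ forall p q X Y,
  nonzero p -> resultant p q <> 0%R -> deg_le n p -> deg_le m q ->
  ~ deg_le 0 q -> 1 <= X -> 1 <= Y -> ht p <= X -> ht q <= Y ->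
  1 <= C * (X ^ m * Y ^ n) * (Rabs (evalR p z) / X + Rabs (evalR q z) / Y).
Proof.
(* The summand 1 makes the constant visibly positive. *)
exists (1 + (n + m)%:R * (n + m)`!%:R * (1 + `|z|) ^+ (n + m))%R.
have C0 : (0 <= (n + m)%:R * (n + m)`!%:R * (1 + `|z|) ^+ (n + m) :> R)%R.
  by rewrite !mulr_ge0 // exprn_ge0 // addr_ge0.
split; first by apply/RltP; rewrite (lt_le_trans ltr01) // lerDl.
move=> p q X Y /eqP p0 /eqP res0 /ssrnat.leP sp /ssrnat.leP sq q1 /RleP X1 /RleP Y1.
rewrite /ht !INRE => /RleP hp /RleP hq.
have q1' : (1 < size q)%N by rewrite ltnNge; apply/negP => ?; apply: q1; apply/ssrnat.leP.
have H := @resultant_ge1 R z X Y p q n m p0 res0 sp sq q1' X1 Y1 hp hq.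
apply/RleP; apply: le_trans H _; rewrite !RpowE !RabsE /evalR.
have X0 := le_trans ler01 X1; have Y0 := le_trans ler01 Y1.
rewrite !(RmultE, RplusE, RdivE) ler_wpM2r ?addr_ge0 ?divr_ge0 //.
by rewrite ler_wpM2r ?mulr_ge0 ?exprn_ge0 // lerDr.
Qed.

(** A zero resultant gives a nonconstant gcd over the rationals. By Gauss's lemma its primitive part
    divides [q] in Z[X], so by indecomposability the cofactor is constant; then [q] is associated to
    the gcd and divides [p], again over Z because [q] is primitive. *)
Lemma resultant_or_dvd p q : nonzero p -> indecomposable q ->
  resultant p q <> 0%R \/ exists r, p = pmul q r.
Proof.
move=> /eqP p0 [q1' [qprim indec]].
have q1 : (1 < size q)%N by rewrite ltnNge; apply/negP => ?; apply: q1'; apply/ssrnat.leP.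
have [/eqP res0 | res0] := boolP (resultant p q == 0%R); last by left; apply/eqP.
right; move/eqP: res0; rewrite resultant_eq0 => g1.
have q0 : q != 0%R by rewrite -size_poly_gt0 (ltn_trans _ q1).
have [a Ea] := dvdpP_int (dvdp_gcdr p q).
have a0 : a != 0%R by apply: contraNneq q0 => a0; rewrite Ea a0 mulr0.
have sa : size a = 1%N.
  case: (indec _ _ Ea) => /ssrnat.leP; rewrite ?size_zprimitive; first by rewrite leqNgt g1.
  by move=> sa; apply/eqP; rewrite eqn_leq sa size_poly_gt0.
have sg : size (gcdp p q) == size q.
  rewrite [in X in _ == X]Ea size_mul ?zprimitive_eq0 ?gcdp_eq0 ?(negPf p0) //.
  by rewrite sa addn1 size_zprimitive.
move: sg; rewrite (dvdp_size_eqp (dvdp_gcdr p q)) => /(eqp_dvdl p).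
rewrite dvdp_gcdl => /esym /dvdpP_int[r Er].
by exists r; rewrite Er qprim.
Qed.

Lemma evalR_const_ge1 p z : nonzero p -> deg_le 0 p -> 1 <= Rabs (evalR p z).
Proof.
move=> /eqP p0 /ssrnat.leP /size1_polyC Ep; rewrite Ep in p0 *.
rewrite polyC_eq0 in p0.
apply/RleP; rewrite RabsE /evalR /ev map_polyC hornerC /=.
by rewrite -intr_norm -abszE -natr_absz ler1n absz_gt0.
Qed.

(** The degrees leave room only for a constant cofactor [r], a nonzero integer. *)
Lemma evalR_dvd_ge p q r n z : p = pmul q r -> nonzero p -> deg_le n p ->
  has_degree n q -> Rabs (evalR q z) <= Rabs (evalR p z).
Proof.
move=> Ep p0; have := p0; rewrite {1}Ep => /nonzero_mul[q0 r0] /ssrnat.leP.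
rewrite Ep size_mul; [|exact/eqP|exact/eqP] => sp sq.
have : 1 <= Rabs (evalR r z).
  apply: evalR_const_ge1 => //; apply/ssrnat.leP; move: sp; rewrite sq addSn /=.
  by rewrite -addn1 leq_add2l.
rewrite evalR_mul Rabs_mult => r1; rewrite -{1}(Rmult_1_r (Rabs (evalR q z))).
by apply: Rmult_le_compat_l => //; exact: Rabs_pos.
Qed.

(** The content is a nonzero integer, so dividing by it enlarges neither the height nor the
    value. *)
Lemma primitive_part p z : nonzero p -> exists q, zprimitive q = q /\ nonzero q /\
  (forall k, deg_le k p -> deg_le k q) /\ ht q <= ht p /\ Rabs (evalR q z) <= Rabs (evalR p z).
Proof.
move=> p0; have c0 : zcontents p != 0%R by rewrite zcontents_eq0; apply/eqP.
exists (zprimitive p); do 4?split; rewrite ?zprimitive_id //.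
- by apply/eqP; rewrite zprimitive_eq0; apply/eqP.
- by move=> k; rewrite /deg_le size_zprimitive.
- apply: le_INR; apply/ssrnat.leP/height_leP => i; rewrite [in X in (_ <= X)%N](zpolyEprim p).
  apply: leq_trans (coef_le_height _ i); rewrite coefZ abszM.
  by apply: leq_pmull; rewrite absz_gt0.
rewrite /evalR /ev [X in _ <= Rabs (map_poly _ X).[_]%R](zpolyEprim p).
rewrite map_polyZ hornerZ Rabs_mult.
rewrite -[X in X <= _]Rmult_1_l; apply: Rmult_le_compat_r; first exact: Rabs_pos.
apply/RleP; rewrite RabsE /=.
by rewrite -intr_norm -abszE -natr_absz ler1n absz_gt0.
Qed.

Lemma deg_le_proper_factor p a b m : nonzero p -> p = pmul a b ->
  has_degree m p -> ~ deg_le 0 b -> deg_le (Nat.sub m 1) a.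
Proof.
move=> p0 Ep; have := p0; rewrite {1}Ep => /nonzero_mul[/eqP a0 /eqP b0].
rewrite /has_degree Ep size_mul // => E nb.
have sb : (1 < size b)%N by rewrite ltnNge; apply/negP => ?; apply: nb; apply/ssrnat.leP.
have sa : (0 < size a)%N by rewrite size_poly_gt0.
have : (size a <= m)%N /\ (0 < m)%N by move: E sa sb; move: (size a) (size b) => u v; clear; lia.
by case=> h1 h2; apply/ssrnat.leP; move: h1 h2; clear; move: (size a) => u; lia.
Qed.

Definition poly_of n (c : nat -> Z) : {poly int} := (\poly_(i < n.+1) int_of_Z (c i))%R.

Lemma intr_int_of_Z (x : Z) : ((int_of_Z x)%:~R)%R = IZR x :> R.
Proof.
case: x => //= u; first by rewrite IZRposE INRE Pos_to_natE.
rewrite NegzE prednK; last by apply/ssrnat.leP; exact: Pos2Nat.is_pos.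
rewrite rmorphN /= -/(Z.opp (Z.pos u)) opp_IZR IZRposE INRE -Pos_to_natE.
by rewrite RoppE.
Qed.

Lemma evalR_poly_of n c z : evalR (poly_of n c) z = peval n c z.
Proof.
rewrite /peval sum_f_R0E big_mkord /evalR /ev (@horner_coef_wide _ n.+1); last first.
  by rewrite (leq_trans (size_poly _ _)) // size_poly.
apply: eq_bigr => i _; rewrite coef_map coef_poly ltn_ord /= intr_int_of_Z.
by rewrite RmultE RpowE.
Qed.

Lemma ht_poly_of n c : ht (poly_of n c) = IZR (pheight n c).
Proof.
have key m : (m <= n)%N -> pheight m c = Z.of_nat (\max_(i < m.+1) `|int_of_Z (c i)|)%N.
  elim: m => [|m IH] le_mn; first by rewrite big_ord_recl big_ord0 /=; lia.
  rewrite big_ord_recr /= IH 1?ltnW //.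
  move: (\max_(i < m.+1) _)%N (c m.+1) => b x; lia.
rewrite /ht INR_IZR_INZ key //; congr (IZR (Z.of_nat _)); apply/eqP.
rewrite eqn_leq; apply/andP; split.
  apply/height_leP => i; rewrite coef_poly; case: ifP => // lt_in.
  exact: (@leq_bigmax _ (fun j : 'I_n.+1 => `|int_of_Z (c j)|%N) (Ordinal lt_in)).
apply/bigmax_leqP => i _; have := coef_le_height (poly_of n c) i.
by rewrite coef_poly ltn_ord.
Qed.

Lemma deg_le_poly_of n c : deg_le n (poly_of n c).
Proof. by apply/ssrnat.leP; rewrite size_poly. Qed.

Lemma nonzero_poly_of n c : nonzero (poly_of n c) <-> pnonzero n c.
Proof.
split=> [p0|[k [/ssrnat.leP le_kn ck]] /polyP/(_ k)].
  apply: Classical_Prop.NNPP => H; apply: p0; apply/polyP => k.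
  rewrite coef_poly coef0; case: ifP => // lt_kn; case: (Z.eq_dec (c k) Z0) => [->//|ck].
  by case: H; exists k; split=> //; apply/ssrnat.leP.
rewrite coef_poly ltnS le_kn coef0 => E; apply: ck; move: E; lia.
Qed.

Lemma poly_of_surj n p : deg_le n p -> exists c, p = poly_of n c.
Proof.
move=> /ssrnat.leP sp; exists (fun k => Z_of_int (p`_k)%R); apply/polyP => k.
rewrite coef_poly Z_of_intK; case: ltnP => // le_nk.
by rewrite nth_default // (leq_trans sp).
Qed.

Lemma pmulC p q : pmul p q = pmul q p.
Proof. by rewrite /pmul mulrC. Qed.

Lemma deg_leW n m p : le n m -> deg_le n p -> deg_le m p.
Proof. by move=> nm /Nat.le_trans; apply; apply: le_n_S. Qed.

Lemma deg_le_exists p : exists n, deg_le n p.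
Proof. by exists (size p); apply/ssrnat.leP. Qed.

Lemma has_degreeP n p : deg_le n p -> (le 1 n) -> ~ deg_le (Nat.sub n 1) p -> has_degree n p.
Proof. rewrite /deg_le /has_degree; move: (size p) => u; lia. Qed.

Lemma has_degree_nonconst n p : has_degree n p -> le 1 n -> ~ deg_le 0 p.
Proof. rewrite /deg_le /has_degree; move: (size p) => u; lia. Qed.

Lemma has_degree_deg_le n p : has_degree n p -> deg_le n p.
Proof. by rewrite /deg_le /has_degree => ->. Qed.

Lemma has_degree_nonzero n p : has_degree n p -> nonzero p.
Proof. by move=> + p0; rewrite /has_degree p0 size_poly0. Qed.

End RealEval.
Import RealEval.

(** * Indecomposable approximations *)

Lemma Rpower_large (a C : R) : 0 < a -> exists X0, 1 <= X0 /\
  forall X, X0 <= X -> C < Rpower X a.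
Proof.
intros Ha.
set (D := Rmax C 0 + 2).
assert (HD : 2 <= D) by (unfold D; pose proof (Rmax_r C 0); lra).
assert (HC : C < D) by (unfold D; pose proof (Rmax_l C 0); lra).
exists (Rpower D (/ a)).
assert (H1 : 1 <= Rpower D (/ a)).
{ rewrite <- (Rpower_O D) by lra.
  apply Rle_Rpower; [lra|]. apply Rlt_le, Rinv_0_lt_compat; lra. }
split; [exact H1|].
intros X HX.
apply Rlt_le_trans with D; [exact HC|].
replace D with (Rpower (Rpower D (/ a)) a).
- apply Rle_Rpower_l; lra.
- rewrite Rpower_mult. replace (/ a * a) with 1 by (field; lra).
  apply Rpower_1; lra.
Qed.

Lemma Rpower_pos (x y : R) : 0 < Rpower x y.
Proof. apply exp_pos. Qed.

Lemma Rpower_opp_le (x y a : R) : 0 < x <= y -> 0 <= a ->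
  Rpower y (- a) <= Rpower x (- a).
Proof.
intros H Ha. rewrite !Rpower_Ropp.
apply Rinv_le_contravar; [apply Rpower_pos|].
apply Rle_Rpower_l; lra.
Qed.

Definition approx (n : nat) (z X nu : R) (p : ipoly) : Prop :=
  nonzero p /\ deg_le n p /\ ht p <= X /\ Rabs (evalR p z) <= Rpower X (- nu).

Lemma approxP (n : nat) (z X nu : R) :
  (exists c, pnonzero n c /\ IZR (pheight n c) <= X /\
     Rabs (peval n c z) <= Rpower X (- nu)) <-> exists p, approx n z X nu p.
Proof.
split.
- intros [c [H1 [H2 H3]]]. exists (poly_of n c). repeat split.
  + now apply nonzero_poly_of.
  + apply deg_le_poly_of.
  + now rewrite ht_poly_of.
  + now rewrite evalR_poly_of.
- intros [p [H1 [H2 [H3 H4]]]].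
  destruct (poly_of_surj n p H2) as [c ->]. exists c. repeat split.
  + now apply nonzero_poly_of.
  + now rewrite <- ht_poly_of.
  + now rewrite <- evalR_poly_of.
Qed.

Lemma approx_weaken (n m : nat) (z X nu mu : R) (p : ipoly) :
  (n <= m)%nat -> mu <= nu -> 1 <= X -> approx n z X nu p -> approx m z X mu p.
Proof.
intros Hnm Hmu HX [H1 [H2 [H3 H4]]]. repeat split; auto.
- eapply deg_leW; eauto.
- apply Rle_trans with (1 := H4). apply Rle_Rpower; lra.
Qed.

Lemma w_set_weaken (n m : nat) (z nu mu : R) :
  (n <= m)%nat -> mu <= nu -> w_set n z nu -> w_set m z mu.
Proof.
intros Hnm Hmu H X0. destruct (H X0) as [X [H1 [H2 H3]]].
exists X. split; [exact H1|]. split; [exact H2|].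
apply approxP. apply approxP in H3. destruct H3 as [p Hp]. exists p.
now apply approx_weaken with n nu.
Qed.

Lemma what_set_weaken (n : nat) (z nu mu : R) :
  mu <= nu -> what_set n z nu -> what_set n z mu.
Proof.
intros Hmu [X0 [H1 H2]]. exists X0. split; [exact H1|]. intros X HX.
apply approxP. specialize (H2 X HX). apply approxP in H2.
destruct H2 as [p Hp]. exists p. apply approx_weaken with n nu; auto; lra.
Qed.

Lemma what_set_w_set (n : nat) (z nu : R) : what_set n z nu -> w_set n z nu.
Proof.
intros [X0 [H1 H2]] Y. exists (Rmax X0 Y).
pose proof (Rmax_l X0 Y). pose proof (Rmax_r X0 Y).
split; [lra|]. split; [lra|]. apply H2; lra.
Qed.

Lemma transcendental_evalR (z : R) (p : ipoly) :
  transcendental z -> nonzero p -> 0 < Rabs (evalR p z).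
Proof.
intros Hz Hp. destruct (deg_le_exists p) as [n Hn].
destruct (poly_of_surj n p Hn) as [c ->].
rewrite evalR_poly_of. apply Rabs_pos_lt, Hz. now apply nonzero_poly_of.
Qed.

Lemma finite_values (z : R) (B : Z) (n : nat) : exists L : list R,
  forall c, (pheight n c <= B)%Z -> In (peval n c z) L.
Proof.
set (range := map (fun i => (Z.of_nat i - B)%Z) (seq 0 (Z.to_nat (2 * B + 1)))).
assert (Hrange : forall k, (Z.abs k <= B)%Z -> In k range).
{ intros k Hk. apply in_map_iff. exists (Z.to_nat (k + B)). split; [lia|].
  apply in_seq. lia. }
induction n as [|n [L IH]].
- exists (map (fun k => IZR k * z ^ 0) range). intros c Hc.
  unfold peval; cbn [sum_f_R0]. apply (in_map (fun k => IZR k * z ^ 0)).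
  apply Hrange, Hc.
- exists (flat_map (fun x => map (fun k => x + IZR k * z ^ (S n)) range) L).
  intros c Hc. cbn [pheight] in Hc. apply in_flat_map.
  exists (peval n c z). split; [apply IH; lia|].
  unfold peval at 1; cbn [sum_f_R0]. fold (peval n c z).
  apply (in_map (fun k => peval n c z + IZR k * z ^ (S n))). apply Hrange; lia.
Qed.

(** Bounded degree and height leave finitely many values, all nonzero by transcendence. This forces
    the heights of ever better approximations to infinity. *)
Lemma evalR_bounded_away (n : nat) (B z : R) : transcendental z ->
  exists d, 0 < d /\ forall p, nonzero p -> deg_le n p -> ht p <= B ->
    d <= Rabs (evalR p z).
Proof.
intros Hz. destruct (finite_values z (up B) n) as [L HL].
assert (Hd : exists d, 0 < d /\ forall x, In x L -> x <> 0 -> d <= Rabs x).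
{ clear HL. induction L as [|a L [d [Hd IH]]].
  - exists 1. split; [lra|]. intros x [].
  - destruct (Req_dec a 0) as [Ha|Ha].
    + exists d. split; [exact Hd|]. intros x [<-|Hx] Hx0; [contradiction|auto].
    + exists (Rmin d (Rabs a)). split.
      * apply Rmin_pos; [exact Hd|now apply Rabs_pos_lt].
      * intros x [<-|Hx] Hx0; [apply Rmin_r|].
        apply Rle_trans with d; [apply Rmin_l|auto]. }
destruct Hd as [d [Hd H]]. exists d. split; [exact Hd|].
intros p Hp Hn Hh. destruct (poly_of_surj n p Hn) as [c ->].
rewrite evalR_poly_of. rewrite ht_poly_of in Hh. apply H.
- apply HL. apply le_IZR. destruct (archimed B). lra.
- apply Hz. now apply nonzero_poly_of.
Qed.

(* A nontrivial factor has degree at most [m - 1], so its value at [z] is at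
   least [c * ht ^ (- mu)]; as heights are multiplicative up to constants, a
   decomposable polynomial cannot reach the exponent [nu > mu]. *)
Lemma indecomposable_approx (m : nat) (z mu nu : R) :
  transcendental z -> (1 <= m)%nat -> 0 < mu < nu ->
  ~ w_set (m - 1) z mu -> w_set m z nu ->
  forall B, exists q, indecomposable q /\ has_degree m q /\ B <= ht q /\
    Rabs (evalR q z) <= Rpower (ht q) (- nu).
Proof.
intros Hz Hm Hmu Hno Hyes B.
assert (Hlow : exists X1, 1 <= X1 /\ forall X p, X1 <= X -> ~ approx (m - 1) z X mu p).
{ apply NNPP. intros Hn. apply Hno. intros X0.
  apply NNPP. intros Hn2. apply Hn. exists (Rmax X0 1).
  pose proof (Rmax_l X0 1). pose proof (Rmax_r X0 1).
  split; [lra|]. intros X p HX Hp. apply Hn2. exists X.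
  split; [lra|]. split; [lra|]. apply approxP. now exists p. }
destruct Hlow as [X1 [HX1 Hlow]].
destruct (ht_mul_le m) as [K [HK Hgel]].
destruct (evalR_bounded_away m B z Hz) as [d [Hd Haway]].
destruct (Rpower_large nu (/ d)) as [Y1 [HY1 HY1']]; [lra|].
(* From here on [X ^ (nu - mu)] exceeds the constant lost when two factors are each bounded below at
   exponent [mu]. *)
destruct (Rpower_large (nu - mu) (Rpower (X1 * X1 * K) mu)) as [Y2 [HY2 HY2']]; [lra|].
destruct (Hyes (X1 + Y1 + Y2)) as [X [HX [HX' Hex]]].
apply approxP in Hex. destruct Hex as [p [Hp0 [Hpm [HpX Hpz]]]].
destruct (primitive_part p z Hp0) as [q [Hprim [Hq0 [Hsz [Hht Hev]]]]].
assert (Hqm : deg_le m q) by now apply Hsz.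
assert (Hqdeg : has_degree m q).
{ apply has_degreeP; auto. intros Hq1. apply (Hlow X q); [lra|].
  repeat split; auto; [lra|].
  apply Rle_trans with (1 := Hev). apply Rle_trans with (1 := Hpz).
  apply Rle_Rpower; lra. }
(* The parameter [X1 * ht a] is at least both [X1] and [ht a], so the lower bound covers factors of
   every height, small ones included. *)
assert (Hfac : forall a, nonzero a -> deg_le (m - 1) a ->
  Rpower (X1 * ht a) (- mu) < Rabs (evalR a z)).
{ intros a Ha0 Ham. apply Rnot_le_lt. intros Hle.
  pose proof (ht_ge1 a Ha0).
  apply (Hlow (X1 * ht a) a); [nra|]. repeat split; auto. nra. }
exists q. split; [split; [|split; [exact Hprim|]]|].
- now apply has_degree_nonconst with m.
- intros a b Eab. apply NNPP. intros Hab.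
  apply not_or_and in Hab. destruct Hab as [Ha Hb].
  assert (Hnab : nonzero (pmul a b)) by now rewrite <- Eab.
  destruct (nonzero_mul a b Hnab) as [Ha0 Hb0].
  assert (Ham : deg_le (m - 1) a) by now apply deg_le_proper_factor with q b.
  assert (Hbm : deg_le (m - 1) b).
  { apply deg_le_proper_factor with q a; auto. now rewrite pmulC. }
  pose proof (ht_ge1 a Ha0) as Hha. pose proof (ht_ge1 b Hb0) as Hhb.
  assert (Hprod : Rpower (X1 * ht a) (- mu) * Rpower (X1 * ht b) (- mu) <= Rpower X (- nu)).
  { apply Rle_trans with (Rabs (evalR q z)); [|lra].
    rewrite Eab, evalR_mul, Rabs_mult.
    apply Rmult_le_compat; try (apply Rlt_le, Rpower_pos); now apply Rlt_le, Hfac. }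
  rewrite Rpower_mult_distr in Hprod by nra.
  assert (Hg : ht a * ht b <= K * X).
  { apply Rle_trans with (K * ht q); [|apply Rmult_le_compat_l; lra].
    rewrite Eab. apply Hgel; [exact Hnab|]. now rewrite <- Eab. }
  assert (Hprod2 : Rpower (X1 * X1 * K * X) (- mu) <= Rpower X (- nu)).
  { apply Rle_trans with (2 := Hprod). apply Rpower_opp_le; [|lra].
    assert (0 < X1 * X1) by nra. assert (0 < ht a * ht b) by nra.
    split; [nra|].
    replace (X1 * ht a * (X1 * ht b)) with (X1 * X1 * (ht a * ht b)) by ring.
    replace (X1 * X1 * K * X) with (X1 * X1 * (K * X)) by ring.
    apply Rmult_le_compat_l; lra. }
  assert (HD : 0 < X1 * X1 * K) by (apply Rmult_lt_0_compat; nra).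
  rewrite <- Rpower_mult_distr in Hprod2 by lra.
  specialize (HY2' X). assert (HX2 : Y2 <= X) by lra. specialize (HY2' HX2).
  assert (E : Rpower X (- nu) = Rpower X (- mu) * / Rpower X (nu - mu)).
  { rewrite <- Rpower_Ropp, <- Rpower_plus. f_equal. ring. }
  rewrite E, Rmult_comm in Hprod2.
  apply Rmult_le_reg_l in Hprod2; [|apply Rpower_pos].
  rewrite Rpower_Ropp in Hprod2.
  pose proof (Rpower_pos (X1 * X1 * K) mu).
  apply Rinv_lt_contravar in HY2'; [lra|].
  apply Rmult_lt_0_compat; lra.
- split; [exact Hqdeg|]. split.
  + apply Rnot_lt_le. intros HB.
    assert (H1 : d <= Rabs (evalR q z)) by (apply Haway; auto; lra).
    specialize (HY1' X). assert (HX2 : Y1 <= X) by lra. specialize (HY1' HX2).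
    assert (H2 : Rpower X (- nu) < d).
    { rewrite Rpower_Ropp. rewrite <- (Rinv_inv d).
      apply Rinv_lt_contravar; [|exact HY1'].
      apply Rmult_lt_0_compat; [now apply Rinv_0_lt_compat|apply Rpower_pos]. }
    lra.
  + apply Rle_trans with (1 := Hev). apply Rle_trans with (1 := Hpz).
    pose proof (ht_ge1 q Hq0). apply Rpower_opp_le; lra.
Qed.

(** * Resultant obstructions *)

(* The parameter [X] is chosen so that [X ^ (- nu)] is half of [|q(z)|], which
   excludes that [q] divides the approximating polynomial [p]; the resultant
   of [p] and [q] is then too small to be a nonzero integer. *)
Lemma no_indecomposable_approx (n m : nat) (z nu W : R) :
  transcendental z -> (1 <= m <= n)%nat -> INR n < nu <= W ->
  INR n - 1 < W * (1 - INR n / nu) ->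
  (exists X0, forall X, X0 <= X -> exists p, approx n z X nu p /\
     forall q r, p = pmul q r -> indecomposable q -> has_degree m q ->
       Rabs (evalR q z) <= Rabs (evalR p z)) ->
  ~ (forall B, exists q, indecomposable q /\ has_degree m q /\ B <= ht q /\
       Rabs (evalR q z) <= Rpower (ht q) (- W)).
Proof.
intros Hz Hm Hnu Hexp [X0 Happ] Hq.
assert (Hn1 : 1 <= INR n) by (apply (le_INR 1); lia).
set (t := INR n / nu) in *.
assert (Ht : 0 < t < 1).
{ unfold t. split; [apply Rdiv_lt_0_compat; lra|].
  apply Rmult_lt_reg_r with nu; [lra|]. unfold Rdiv.
  rewrite Rmult_assoc, Rinv_l by lra. lra. }
(* The surplus in the exponent hypothesis: the resultant inequality will read
   [1 <= 4 * C * H ^ (- eta)], false for large [H]. *)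
set (eta := W * (1 - t) - (INR n - 1)).
destruct (resultant_bound n m z) as [C [HC Hres]].
destruct (Rpower_large eta (4 * C)) as [B1 [HB1 HB1']]; [unfold eta; lra|].
destruct (Hq (Rmax X0 B1)) as [q [Hind [Hdeg [HB Hqz]]]].
pose proof (Rmax_l X0 B1) as HmaxX. pose proof (Rmax_r X0 B1) as HmaxB.
set (H := ht q) in *. set (y := Rabs (evalR q z)) in *.
assert (HH1 : 1 <= H) by lra.
assert (Hq0 : nonzero q) by now apply has_degree_nonzero with m.
assert (Hy : 0 < y) by now apply transcendental_evalR.
assert (HyW : Rpower H W <= 2 / y).
{ rewrite Rpower_Ropp in Hqz. apply Rle_trans with (/ y).
  - rewrite <- (Rinv_inv (Rpower H W)). apply Rinv_le_contravar; assumption.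
  - unfold Rdiv. assert (0 < / y) by now apply Rinv_0_lt_compat. lra. }
assert (H2y : 0 < 2 / y) by (apply Rdiv_lt_0_compat; lra).
set (X := Rpower (2 / y) (/ nu)).
(* This is where [nu <= W] enters: [H ^ nu <= H ^ W <= 2 / y = X ^ nu]. *)
assert (HXH : H <= X).
{ replace H with (Rpower (Rpower H nu) (/ nu)).
  - apply Rle_Rpower_l; [apply Rlt_le, Rinv_0_lt_compat; lra|].
    split; [apply Rpower_pos|]. apply Rle_trans with (2 := HyW).
    apply Rle_Rpower; lra.
  - rewrite Rpower_mult, Rinv_r by lra. apply Rpower_1; lra. }
destruct (Happ X) as [p [[Hp0 [Hpn [HpX Hpz]]] Hdvd]]; [lra|].
assert (EX : Rpower X (- nu) = y / 2).
{ unfold X. rewrite Rpower_mult.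
  replace (/ nu * - nu) with (- (1)) by (field; lra).
  rewrite Rpower_Ropp, Rpower_1 by lra. field; lra. }
rewrite EX in Hpz.
destruct (resultant_or_dvd p q Hp0 Hind) as [Hr|[r Er]].
2: { specialize (Hdvd q r Er Hind Hdeg). fold y in Hdvd. lra. }
assert (Hle : 1 <= C * (X ^ m * H ^ n) * (Rabs (evalR p z) / X + y / H)).
{ apply Hres; auto; try lra.
  - now apply has_degree_deg_le.
  - apply has_degree_nonconst with m; [exact Hdeg|lia].
  - apply Rle_refl. }
(* Since [|p(z)| <= y / 2] and [H <= X], the term of [q] dominates. *)
assert (Hsum : Rabs (evalR p z) / X + y / H <= 2 * (y / H)).
{ assert (Rabs (evalR p z) / X <= y / H); [|lra].
  unfold Rdiv. apply Rmult_le_compat.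
  - apply Rabs_pos.
  - apply Rlt_le, Rinv_0_lt_compat; lra.
  - lra.
  - apply Rinv_le_contravar; lra. }
assert (HXm : X ^ m <= X ^ n) by (apply Rle_pow; [lra|lia]).
assert (HHn : 0 < H ^ n) by (apply pow_lt; lra).
assert (HXm0 : 0 < X ^ m) by (apply pow_lt; lra).
assert (Hle2 : 1 <= 2 * C * (X ^ n * H ^ n * (y / H))).
{ apply Rle_trans with (1 := Hle).
  apply Rle_trans with (C * (X ^ m * H ^ n) * (2 * (y / H))).
  - apply Rmult_le_compat_l; [|exact Hsum].
    apply Rlt_le, Rmult_lt_0_compat; [lra|]. now apply Rmult_lt_0_compat.
  - replace (C * (X ^ m * H ^ n) * (2 * (y / H)))
      with (2 * C * (X ^ m * H ^ n * (y / H))) by ring.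
    apply Rmult_le_compat_l; [lra|]. apply Rmult_le_compat_r.
    + apply Rlt_le, Rdiv_lt_0_compat; lra.
    + apply Rmult_le_compat_r; lra. }
assert (E1 : X ^ n * y = 2 * Rpower (2 / y) (t - 1)).
{ rewrite <- Rpower_pow by (unfold X; apply Rpower_pos).
  unfold X. rewrite Rpower_mult.
  replace (/ nu * INR n) with (1 + (t - 1)) by (unfold t; field; lra).
  rewrite Rpower_plus, Rpower_1 by lra. field; lra. }
assert (E2 : H ^ n / H = Rpower H (INR n - 1)).
{ unfold Rminus. rewrite Rpower_plus, Rpower_pow, Rpower_Ropp, Rpower_1 by lra.
  reflexivity. }
(* The exponent [t - 1] is negative, so the lower bound [H ^ W] for [2 / y] becomes an upper
   bound. *)
assert (H3 : Rpower (2 / y) (t - 1) <= Rpower H (W * (t - 1))).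
{ replace (t - 1) with (- (1 - t)) by ring.
  rewrite <- Rpower_mult. apply Rpower_opp_le; [|lra].
  split; [apply Rpower_pos|exact HyW]. }
assert (Hle3 : 1 <= 4 * C * Rpower H (- eta)).
{ apply Rle_trans with (1 := Hle2).
  replace (X ^ n * H ^ n * (y / H)) with (X ^ n * y * (H ^ n / H)) by (field; lra).
  rewrite E1, E2.
  replace (2 * C * (2 * Rpower (2 / y) (t - 1) * Rpower H (INR n - 1)))
    with (4 * C * (Rpower (2 / y) (t - 1) * Rpower H (INR n - 1))) by ring.
  apply Rmult_le_compat_l; [lra|].
  replace (- eta) with (W * (t - 1) + (INR n - 1)) by (unfold eta; ring).
  rewrite Rpower_plus. apply Rmult_le_compat_r; [|exact H3].
  apply Rlt_le, Rpower_pos. }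
assert (H4 : 4 * C < Rpower H eta) by (apply HB1'; lra).
rewrite Rpower_Ropp in Hle3.
pose proof (Rpower_pos H eta).
apply Rmult_le_compat_r with (r := Rpower H eta) in Hle3; [|lra].
rewrite Rmult_assoc, Rinv_l in Hle3 by lra. lra.
Qed.

(* Here [X] is a small multiple of the height of [q]: by near multiplicativity
   of heights [q] cannot divide a nonzero polynomial of height at most [X]. *)
Lemma what_set_small_degree (n m : nat) (z nu W : R) :
  transcendental z -> (1 <= m <= n)%nat ->
  INR m + INR n - 1 < nu -> INR m + INR n - 1 < W ->
  what_set n z nu ->
  ~ (forall B, exists q, indecomposable q /\ has_degree m q /\ B <= ht q /\
       Rabs (evalR q z) <= Rpower (ht q) (- W)).
Proof.
intros Hz Hm Hnu HW [X0 [HX0 Happ]] Hq.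
destruct (resultant_bound n m z) as [C [HC Hres]].
destruct (ht_mul_le n) as [K [HK Hgel]].
set (s := INR m + INR n - 1) in *.
assert (Hpow : 0 < (2 * K) ^ n) by (apply pow_lt; lra).
destruct (Rpower_large (nu - s) (2 * (C * (2 * K) ^ n))) as [B1 [HB1 HB1']]; [lra|].
destruct (Rpower_large (W - s) (2 * C)) as [B2 [HB2 HB2']]; [lra|].
destruct (Hq (2 * K * (X0 + B1) + B2)) as [q [Hind [Hdeg [HB Hqz]]]].
set (H := ht q) in *.
assert (Hq0 : nonzero q) by now apply has_degree_nonzero with m.
assert (Hbig : 1 <= 2 * K * (X0 + B1)) by nra.
set (X := H / (2 * K)).
assert (EH : H = 2 * K * X) by (unfold X; field; lra).
assert (HX : X0 + B1 <= X).
{ apply Rmult_le_reg_l with (2 * K); [lra|]. rewrite <- EH. lra. }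
assert (HXH : X <= H) by (rewrite EH; nra).
pose proof (Happ X ltac:(lra)) as Hp. apply approxP in Hp.
destruct Hp as [p [Hp0 [Hpn [HpX Hpz]]]].
destruct (resultant_or_dvd p q Hp0 Hind) as [Hr|[r Er]].
(* Divisibility would give [H <= H * ht r <= K * ht p <= K * X = H / 2]. *)
2: { assert (Hnz : nonzero (pmul q r)) by now rewrite <- Er.
  destruct (nonzero_mul q r Hnz) as [_ Hr0].
  pose proof (ht_ge1 r Hr0).
  assert (Hg : H * ht r <= K * ht p).
  { rewrite Er. apply Hgel; [exact Hnz|]. now rewrite <- Er. }
  nra. }
assert (Hle : 1 <= C * (X ^ m * H ^ n) * (Rabs (evalR p z) / X + Rabs (evalR q z) / H)).
{ apply Hres; auto; try lra.
  - now apply has_degree_deg_le.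
  - apply has_degree_nonconst with m; [exact Hdeg|lia].
  - apply Rle_refl. }
assert (HXm0 : 0 < X ^ m) by (apply pow_lt; lra).
assert (HHn : 0 < H ^ n) by (apply pow_lt; lra).
(* Writing [H = 2 * K * X] turns the term of [p] into a pure power of [X], at the cost of
   [(2 * K) ^ n]. Each of the two terms ends below 1/2. *)
assert (T1 : X ^ m * H ^ n * (Rabs (evalR p z) / X) <= (2 * K) ^ n * Rpower X (- (nu - s))).
{ apply Rle_trans with (X ^ m * H ^ n * (Rpower X (- nu) / X)).
  - apply Rmult_le_compat_l; [apply Rlt_le; now apply Rmult_lt_0_compat|].
    unfold Rdiv. apply Rmult_le_compat_r; [|exact Hpz].
    apply Rlt_le, Rinv_0_lt_compat; lra.
  - rewrite EH at 1. rewrite Rpow_mult_distr.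
    replace (- (nu - s)) with (INR m + INR n + - nu + - (1)) by (unfold s; ring).
    rewrite !Rpower_plus, !Rpower_pow, (Rpower_Ropp X 1), Rpower_1 by lra.
    apply Req_le. field; lra. }
assert (T2 : X ^ m * H ^ n * (Rabs (evalR q z) / H) <= Rpower H (- (W - s))).
{ apply Rle_trans with (H ^ m * H ^ n * (Rpower H (- W) / H)).
  - apply Rmult_le_compat.
    + apply Rlt_le; now apply Rmult_lt_0_compat.
    + unfold Rdiv. apply Rmult_le_pos; [apply Rabs_pos|].
      apply Rlt_le, Rinv_0_lt_compat; lra.
    + apply Rmult_le_compat_r; [lra|]. apply pow_incr; lra.
    + unfold Rdiv. apply Rmult_le_compat_r; [|exact Hqz].
      apply Rlt_le, Rinv_0_lt_compat; lra.
  - replace (- (W - s)) with (INR m + INR n + - W + - (1)) by (unfold s; ring).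
    rewrite !Rpower_plus, !Rpower_pow, (Rpower_Ropp H 1), Rpower_1 by lra.
    apply Req_le. field; lra. }
assert (S1 : C * ((2 * K) ^ n * Rpower X (- (nu - s))) < / 2).
{ specialize (HB1' X ltac:(lra)). rewrite Rpower_Ropp.
  pose proof (Rpower_pos X (nu - s)).
  apply Rmult_lt_reg_r with (Rpower X (nu - s)); [lra|].
  replace (C * ((2 * K) ^ n * / Rpower X (nu - s)) * Rpower X (nu - s))
    with (C * (2 * K) ^ n) by (field; lra). lra. }
assert (S2 : C * Rpower H (- (W - s)) < / 2).
{ specialize (HB2' H ltac:(lra)). rewrite Rpower_Ropp.
  pose proof (Rpower_pos H (W - s)).
  apply Rmult_lt_reg_r with (Rpower H (W - s)); [lra|].
  rewrite Rmult_assoc, Rinv_l by lra. lra. }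
apply Rmult_le_compat_l with (r := C) in T1; [|lra].
apply Rmult_le_compat_l with (r := C) in T2; [|lra].
rewrite Rmult_assoc, Rmult_plus_distr_l, Rmult_plus_distr_l in Hle. lra.
Qed.

(** * Regular graph function and exponents *)

Lemma ER_sup_exists (S : R -> Prop) : exists e, is_ER_sup S e.
Proof.
destruct (classic (exists x, S x)) as [[x0 Hx0]|Hemp].
2: { exists ENInf. split; [|intros; exact I]. intros x Hx. apply Hemp. now exists x. }
destruct (classic (bound S)) as [Hb|Hb].
- destruct (completeness S Hb (ex_intro _ x0 Hx0)) as [l [Hub Hlub]].
  exists (EFin l). split; [exact Hub|].
  intros [|r|] He.
  + exact (He x0 Hx0).
  + apply Hlub. exact He.
  + exact I.
- exists EPInf. split; [intros; exact I|].
  intros [|r|] He.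
  + exact (He x0 Hx0).
  + apply Hb. exists r. exact He.
  + exact I.
Qed.

Lemma ER_sup_le (S : R -> Prop) (e : ER) (b : R) :
  is_ER_sup S e -> (forall x, S x -> x <= b) -> ER_le e (EFin b).
Proof. intros [_ H] Hb. apply H. exact Hb. Qed.

(** Convexity of the [n]-th power on the segment from 1 to [x]. *)
Lemma pow_chord (n : nat) (x t : R) : 0 <= t <= 1 -> 1 <= x ->
  (1 - t + t * x) ^ n <= 1 - t + t * x ^ n.
Proof.
intros Ht Hx. induction n as [|n IH]; simpl; [lra|].
assert (Hxn : 1 <= x ^ n) by now apply pow_R1_Rle.
assert (H : 0 <= 1 - t + t * x) by nra.
apply Rle_trans with ((1 - t + t * x) * (1 - t + t * x ^ n)).
- now apply Rmult_le_compat_l.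
- assert (0 <= t * (1 - t) * ((x - 1) * (x ^ n - 1))).
  { apply Rmult_le_pos; apply Rmult_le_pos; lra. }
  nra.
Qed.

(** Intermediate value theorem for [(w - v + 1) * v ^ n - w ^ n] on [[n, T]]: Bernoulli's inequality
    gives the sign at [n], the hypothesis the sign at [T]. As [T < w], the root is not the trivial
    one [v = w], so it is the value of the regular graph function at [w]. *)
Lemma phi_root (n : nat) (w T : R) : (1 <= n)%nat -> INR n <= T < w ->
  (w / T) ^ n <= w - T + 1 ->
  exists v, INR n <= v <= T /\ w - v + 1 = (w / v) ^ n.
Proof.
intros Hn HT Hle.
assert (Hn1 : 1 <= INR n) by (apply (le_INR 1); lia).
assert (Hdiv : forall v, 0 < v -> (w / v) ^ n * v ^ n = w ^ n).
{ intros v Hv. rewrite <- Rpow_mult_distr. f_equal. field; lra. }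
set (g := fun v => (w - v + 1) * v ^ n - w ^ n).
assert (Hg1 : g (INR n) <= 0).
{ unfold g. rewrite <- (Hdiv (INR n)) by lra.
  assert (Hb := poly n ((w - INR n) / INR n)).
  replace (1 + INR n * ((w - INR n) / INR n)) with (w - INR n + 1) in Hb by (field; lra).
  replace (1 + (w - INR n) / INR n) with (w / INR n) in Hb by (field; lra).
  assert (0 < (w - INR n) / INR n) by (apply Rdiv_lt_0_compat; lra).
  specialize (Hb H). assert (0 < INR n ^ n) by (apply pow_lt; lra). nra. }
assert (Hg2 : 0 <= g T).
{ unfold g. rewrite <- (Hdiv T) by lra.
  assert (0 < T ^ n) by (apply pow_lt; lra). nra. }
assert (Hc : continuity g) by (unfold g; reg).
destruct (IVT_cor g (INR n) T Hc) as [v [Hv Hgv]]; [lra|nra|].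
exists v. split; [exact Hv|]. unfold g in Hgv.
assert (0 < v ^ n) by (apply pow_lt; lra).
apply Rmult_eq_reg_r with (v ^ n); [|lra]. rewrite Hdiv; lra.
Qed.

(** If no exponent exceeded [W], then [w_n] would be finite and lie in [(T, W]]. The inequality
    [(w / T) ^ n <= w - T + 1] is an equality at [w = T] and assumed at [W], hence holds in between
    by convexity. So [phi_n(w_n) <= T], against [T < nu]. *)
Lemma SS_conj_w_set_large (n : nat) (z T W nu : R) : (1 <= n)%nat -> SS_conj n z ->
  INR n <= T < W -> (W / T) ^ n <= W - T + 1 ->
  what_set n z nu -> T < nu -> exists nu', W < nu' /\ w_set n z nu'.
Proof.
intros Hn HSS HT HW Hnu HTnu. apply NNPP. intros Hno.
assert (Hn1 : 1 <= INR n) by (apply (le_INR 1); lia).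
assert (Hub : forall x, w_set n z x -> x <= W).
{ intros x Hx. apply Rnot_lt_le. intros Hlt. apply Hno. now exists x. }
destruct (ER_sup_exists (w_set n z)) as [a Ha].
destruct (ER_sup_exists (what_set n z)) as [b Hb].
pose proof (ER_sup_le _ _ _ Ha Hub) as HaW.
pose proof (proj1 Ha nu (what_set_w_set _ _ _ Hnu)) as Hnua.
destruct a as [|w|]; simpl in HaW, Hnua; try contradiction.
assert (Hw : (w / T) ^ n <= w - T + 1).
{ set (t := (w - T) / (W - T)).
  assert (Ht : 0 <= t <= 1).
  { unfold t. split.
    - apply Rlt_le, Rdiv_lt_0_compat; lra.
    - apply Rmult_le_reg_r with (W - T); [lra|].
      unfold Rdiv. rewrite Rmult_assoc, Rinv_l by lra. lra. }
  assert (Hx : 1 <= W / T).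
  { apply Rmult_le_reg_r with T; [lra|]. unfold Rdiv.
    rewrite Rmult_assoc, Rinv_l by lra. lra. }
  pose proof (pow_chord n (W / T) t Ht Hx) as Hch.
  replace (1 - t + t * (W / T)) with (w / T) in Hch by (unfold t; field; lra).
  apply Rle_trans with (1 := Hch).
  replace (w - T + 1) with (1 - t + t * (W - T + 1)) by (unfold t; field; lra).
  apply Rplus_le_compat_l, Rmult_le_compat_l; lra. }
destruct (phi_root n w T Hn) as [v [Hv Ev]]; [lra|exact Hw|].
assert (Hbv : ER_le b (EFin v)).
{ apply (HSS (EFin w) b (EFin v) Ha Hb). right; right. exists w, v.
  repeat split; auto; lra. }
pose proof (proj1 Hb nu Hnu) as Hnub.
destruct b as [|b|]; simpl in Hbv, Hnub; try contradiction. lra.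
Qed.

(** Descend from [N] as long as the next lower degree still reaches the midpoint of [W] and the
    current exponent; halving the excess keeps it positive. The descent stops before degree 0, where
    values are nonzero integers. *)
Lemma w_set_drop (N : nat) (z W nu : R) : 0 <= W < nu -> w_set N z nu ->
  exists m mu nu1, (1 <= m <= N)%nat /\ W < mu < nu1 /\
    ~ w_set (m - 1) z mu /\ w_set m z nu1.
Proof.
revert nu. induction N as [|N IH]; intros nu Hnu Hw.
(* Asking for [X >= 2] makes [X ^ (- nu)] strictly less than 1. *)
- exfalso. destruct (Hw 2) as [X [HX [HX1 [c [[k [Hk Hck]] [_ Hc]]]]]].
  assert (k = 0%nat) by lia. subst k.
  unfold peval in Hc; simpl in Hc. rewrite Rmult_1_r in Hc.
  assert (1 <= Rabs (IZR (c 0%nat))).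
  { rewrite <- abs_IZR. apply IZR_le. lia. }
  assert (Rpower X (- nu) < 1).
  { rewrite <- (Rpower_O X) by lra. apply Rpower_lt; lra. }
  lra.
- destruct (classic (w_set N z ((W + nu) / 2))) as [H|H].
  + destruct (IH ((W + nu) / 2)) as [m [mu [nu1 [H1 H2]]]]; [lra|exact H|].
    exists m, mu, nu1. split; [lia|exact H2].
  + exists (S N), ((W + nu) / 2), nu. split; [lia|]. split; [lra|].
    split; [|exact Hw]. now replace (S N - 1)%nat with N by lia.
Qed.

(** * From algebraic approximations to small polynomial values *)

Lemma pow_lipschitz (z : R) (k : nat) : exists M, 0 < M /\
  forall a, Rabs (z - a) <= 1 -> Rabs (z ^ k - a ^ k) <= M * Rabs (z - a).
Proof.
induction k as [|k [M [HM IH]]].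
- exists 1. split; [lra|]. intros a _. simpl.
  rewrite Rminus_diag, Rabs_R0. pose proof (Rabs_pos (z - a)). lra.
- assert (Hp : 0 < (Rabs z + 1) ^ k).
  { apply pow_lt. pose proof (Rabs_pos z). lra. }
  pose proof (Rabs_pos z).
  exists (Rabs z * M + (Rabs z + 1) ^ k). split; [nra|]. intros a Ha.
  replace (z ^ S k - a ^ S k) with (z * (z ^ k - a ^ k) + a ^ k * (z - a)) by (simpl; ring).
  apply Rle_trans with (1 := Rabs_triang _ _). rewrite !Rabs_mult.
  rewrite Rmult_plus_distr_r. apply Rplus_le_compat.
  + rewrite Rmult_assoc. apply Rmult_le_compat_l; auto.
  + apply Rmult_le_compat_r; [apply Rabs_pos|]. rewrite <- RPow_abs.
    apply pow_incr. split; [apply Rabs_pos|].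
    replace a with (z + - (z - a)) by ring.
    apply Rle_trans with (1 := Rabs_triang _ _). rewrite Rabs_Ropp. lra.
Qed.

(** Applied at a root [a], this bounds the value at [z]; the constant depends on [z] and [n]
    only. *)
Lemma peval_lipschitz (z : R) (n : nat) : exists L, 0 < L /\
  forall d c a, (d <= n)%nat -> Rabs (z - a) <= 1 ->
    Rabs (peval d c z - peval d c a) <= L * (IZR (pheight d c) * Rabs (z - a)).
Proof.
induction n as [|n [L [HL IH]]].
- exists 1. split; [lra|]. intros d c a Hd _. assert (d = 0%nat) by lia. subst d.
  unfold peval; cbn [sum_f_R0 pheight pow]. rewrite Rminus_diag, Rabs_R0, Rmult_1_l.
  apply Rmult_le_pos; [apply IZR_le; lia|apply Rabs_pos].
- destruct (pow_lipschitz z (S n)) as [M [HM Hpow]].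
  exists (L + M). split; [lra|]. intros d c a Hd Ha.
  assert (Hh : 0 <= IZR (pheight d c)) by (apply IZR_le; destruct d; cbn [pheight]; lia).
  pose proof (Rabs_pos (z - a)) as Hza.
  assert (H0 : 0 <= IZR (pheight d c) * Rabs (z - a)) by now apply Rmult_le_pos.
  destruct (Nat.eq_dec d (S n)) as [->|Hne].
  + unfold peval; cbn [sum_f_R0]. fold (peval n c z) (peval n c a).
    replace (peval n c z + IZR (c (S n)) * z ^ S n - (peval n c a + IZR (c (S n)) * a ^ S n))
      with ((peval n c z - peval n c a) + IZR (c (S n)) * (z ^ S n - a ^ S n)) by ring.
    apply Rle_trans with (1 := Rabs_triang _ _). rewrite Rmult_plus_distr_r.
    apply Rplus_le_compat.
    * apply Rle_trans with (1 := IH n c a (le_n n) Ha).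
      apply Rmult_le_compat_l; [lra|]. apply Rmult_le_compat_r; [exact Hza|].
      apply IZR_le. cbn [pheight]. lia.
    * rewrite Rabs_mult.
      replace (M * (IZR (pheight (S n) c) * Rabs (z - a)))
        with (IZR (pheight (S n) c) * (M * Rabs (z - a))) by ring.
      apply Rmult_le_compat; auto using Rabs_pos.
      rewrite <- abs_IZR. apply IZR_le. cbn [pheight]. lia.
  + apply Rle_trans with (1 := IH d c a ltac:(lia) Ha). nra.
Qed.

(** In a factorization into two nonconstant factors both would have degree below [d], and one of
    them would vanish at [alpha], against minimality. *)
Lemma minimal_poly (alpha : R) (d : nat) (h : R) : (1 <= d)%nat ->
  alg_deg_height alpha d h -> exists c, h = IZR (pheight d c) /\
    nonzero (poly_of d c) /\ peval d c alpha = 0 /\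
    forall q r, poly_of d c = pmul q r -> ~ deg_le 0 q -> deg_le 0 r.
Proof.
intros Hd [c [Hcd [_ [Hroot [_ [Hmin Hh]]]]]].
assert (Hnz : nonzero (poly_of d c)).
{ apply nonzero_poly_of. exists d. auto. }
exists c. repeat split; auto.
intros q r Eqr Hq. apply NNPP. intros Hr.
assert (Hdeg : has_degree d (poly_of d c)).
{ apply has_degreeP; auto; [apply deg_le_poly_of|]. intros Hlow.
  destruct (poly_of_surj _ _ Hlow) as [c' Ec'].
  apply (Hmin (d - 1)%nat c'); [lia|now apply nonzero_poly_of; rewrite <- Ec'|].
  rewrite <- evalR_poly_of, <- Ec', evalR_poly_of. exact Hroot. }
assert (Hne : forall a, nonzero a -> deg_le (d - 1) a -> evalR a alpha <> 0).
{ intros a Ha Had. destruct (poly_of_surj _ _ Had) as [c' ->].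
  rewrite evalR_poly_of. apply Hmin; [lia|]. now apply nonzero_poly_of. }
assert (Hnqr : nonzero (pmul q r)) by now rewrite <- Eqr.
destruct (nonzero_mul q r Hnqr) as [Hq0 Hr0].
assert (Hqd : deg_le (d - 1) q) by now apply deg_le_proper_factor with (poly_of d c) r.
assert (Hrd : deg_le (d - 1) r).
{ apply deg_le_proper_factor with (poly_of d c) q; auto. now rewrite pmulC. }
rewrite <- evalR_poly_of, Eqr, evalR_mul in Hroot.
apply Rmult_integral in Hroot. destruct Hroot as [H|H].
- now apply (Hne q).
- now apply (Hne r).
Qed.

(** The minimal polynomials of the approximating numbers serve; lowering [nu] to [nu0] absorbs the
    Lipschitz constant. *)
Lemma whatstar_set_approx (n : nat) (z nu nu0 : R) : 0 <= nu0 < nu ->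
  whatstar_set n z nu -> exists X0, 1 <= X0 /\ forall X, X0 <= X ->
    exists p, approx n z X nu0 p /\
      forall q r, p = pmul q r -> ~ deg_le 0 q -> deg_le 0 r.
Proof.
intros Hnu [X1 [HX1 Hstar]].
destruct (peval_lipschitz z n) as [L [HL Hlip]].
destruct (Rpower_large (nu - nu0) L) as [X2 [HX2 HX2']]; [lra|].
exists (X1 + X2). split; [lra|]. intros X HX.
destruct (Hstar X ltac:(lra)) as [alpha [d [h [Hd [Halg [HhX [_ Hza]]]]]]].
destruct (minimal_poly alpha d h ltac:(lia) Halg) as [c [Hh [Hnz [Hroot Hirr]]]].
exists (poly_of d c). split; [|exact Hirr].
pose proof (ht_ge1 _ Hnz) as Hht. rewrite ht_poly_of, <- Hh in Hht.
assert (HX1' : Rpower X (- nu) <= 1).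
{ rewrite <- (Rpower_O X) by lra. apply Rle_Rpower; lra. }
pose proof (Rpower_pos X (- nu)) as Hpos.
assert (Hprod : h * Rabs (z - alpha) <= Rpower X (- nu)).
{ apply Rmult_le_compat_l with (r := h) in Hza; [|lra].
  rewrite <- Rmult_assoc, Rinv_r, Rmult_1_l in Hza by lra. exact Hza. }
assert (Hza1 : Rabs (z - alpha) <= 1).
{ pose proof (Rabs_pos (z - alpha)). nra. }
repeat split.
- exact Hnz.
- apply deg_leW with d; [lia|]. apply deg_le_poly_of.
- rewrite ht_poly_of. lra.
- rewrite evalR_poly_of. replace (peval d c z) with (peval d c z - peval d c alpha) by lra.
  apply Rle_trans with (1 := Hlip d c alpha ltac:(lia) Hza1).
  rewrite <- Hh.
  replace (- nu0) with (- nu + (nu - nu0)) by ring. rewrite Rpower_plus, Rmult_comm.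
  apply Rmult_le_compat; try lra.
  + apply Rmult_le_pos; [lra|apply Rabs_pos].
  + apply Rlt_le, HX2'. lra.
Qed.

Lemma indecomposable_approx_below (m : nat) (z mu nu W : R) :
  transcendental z -> (1 <= m)%nat -> 0 < mu < nu -> W <= nu ->
  ~ w_set (m - 1) z mu -> w_set m z nu ->
  forall B, exists q, indecomposable q /\ has_degree m q /\ B <= ht q /\
    Rabs (evalR q z) <= Rpower (ht q) (- W).
Proof.
intros Hz Hm Hmu HW Hno Hyes B.
destruct (indecomposable_approx m z mu nu Hz Hm Hmu Hno Hyes B)
  as [q [Hq1 [Hq2 [Hq3 Hq4]]]].
exists q. split; [exact Hq1|]. split; [exact Hq2|]. split; [exact Hq3|].
pose proof (ht_ge1 q (has_degree_nonzero m q Hq2)).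
apply Rle_trans with (1 := Hq4). apply Rle_Rpower; lra.
Qed.

(** * Upper bounds for the uniform exponents from a threshold *)

(** The third clause says [T = n W / (W - n + 1)], the resultant bound at exponent [W]; the last one
    ensures [phi_n(W) <= T]. *)
Definition threshold (n : nat) (T W : R) : Prop :=
  INR n < T /\ T < W /\ W * (T - INR n) = T * (INR n - 1) /\
  (W / T) ^ n <= W - T + 1.

(** The third clause of [threshold] is the equality case at [nu = T], and the right-hand side
    increases with [nu]. *)
Lemma threshold_exponent (n : nat) (T W nu : R) : (1 <= n)%nat ->
  threshold n T W -> T < nu -> INR n - 1 < W * (1 - INR n / nu).
Proof.
intros Hn [H1 [H2 [H3 _]]] Hnu.
assert (Hn1 : 1 <= INR n) by (apply (le_INR 1); lia).
replace (INR n - 1) with (W * (1 - INR n / T)).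
- apply Rmult_lt_compat_l; [lra|]. apply Rplus_lt_compat_l, Ropp_lt_contravar.
  unfold Rdiv. apply Rmult_lt_compat_l; [lra|]. apply Rinv_lt_contravar; nra.
- apply Rmult_eq_reg_r with T; [|lra].
  replace (W * (1 - INR n / T) * T) with (W * (T - INR n)) by (field; lra). lra.
Qed.

Lemma whatstar_le_threshold (n : nat) (z T W nu : R) : (1 <= n)%nat ->
  transcendental z -> SS_conj n z -> threshold n T W ->
  whatstar_set n z nu -> nu <= T.
Proof.
intros Hn Hz HSS Hth Hnu. apply Rnot_lt_le. intros HT.
pose proof Hth as [H1 [H2 [H3 H4]]]. pose proof (pos_INR n).
(* Strictly above [T] to contradict the threshold, below [nu] to pay the Lipschitz loss, and at most
   [W] for the resultant argument. *)
set (nu0 := (T + Rmin nu W) / 2).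
pose proof (Rmin_l nu W). pose proof (Rmin_r nu W).
assert (Hmin : T < Rmin nu W) by (apply Rmin_glb_lt; lra).
destruct (whatstar_set_approx n z nu nu0) as [X0 [HX0 Happ]]; [unfold nu0; lra|exact Hnu|].
assert (Hw : what_set n z nu0).
{ exists X0. split; [exact HX0|]. intros X HX. apply approxP.
  destruct (Happ X HX) as [p [Hp _]]. now exists p. }
destruct (SS_conj_w_set_large n z T W nu0 Hn HSS) as [nu' [Hnu' Hw']];
  auto; try (unfold nu0; lra).
destruct (w_set_drop n z W nu') as [m [mu [nu1 [Hm [Hmu [Hno Hyes]]]]]]; [lra|exact Hw'|].
apply (no_indecomposable_approx n m z nu0 W); auto.
- unfold nu0; lra.
- apply threshold_exponent with T; auto. unfold nu0; lra.
- exists X0. intros X HX. destruct (Happ X HX) as [p [Hp Hirr]].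
  exists p. split; [exact Hp|]. intros q r Eqr [Hq _] _.
  assert (Hnz : nonzero (pmul q r)) by (rewrite <- Eqr; apply Hp).
  pose proof (evalR_const_ge1 r z (proj2 (nonzero_mul q r Hnz)) (Hirr q r Eqr Hq)).
  rewrite Eqr, evalR_mul, Rabs_mult. pose proof (Rabs_pos (evalR q z)). nra.
- apply indecomposable_approx_below with mu nu1; auto; lra || lia.
Qed.

(** For [m = n], divisibility by [q] leaves a constant cofactor, so comparing values excludes it.
    For smaller [m], comparing heights excludes it and gives the bound [m + n - 1]. *)
Lemma what_le_of_degree_drop (n m : nat) (z T W mu nu1 nu : R) : (1 <= m <= n)%nat ->
  transcendental z -> threshold n T W -> m = n \/ INR m + INR n - 1 <= T ->
  W < mu < nu1 -> ~ w_set (m - 1) z mu -> w_set m z nu1 ->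
  what_set n z nu -> nu <= T.
Proof.
intros Hm Hz Hth Hcase Hmu Hno Hyes Hnu. apply Rnot_lt_le. intros HT.
pose proof Hth as [H1 [H2 [H3 H4]]]. pose proof (pos_INR n).
assert (Hind : forall B, exists q, indecomposable q /\ has_degree m q /\ B <= ht q /\
    Rabs (evalR q z) <= Rpower (ht q) (- W)).
{ apply indecomposable_approx_below with mu nu1; auto; lra || lia. }
revert Hind. destruct Hcase as [->|Hle].
- set (nu0 := (T + Rmin nu W) / 2).
  pose proof (Rmin_l nu W). pose proof (Rmin_r nu W).
  assert (Hmin : T < Rmin nu W) by (apply Rmin_glb_lt; lra).
  apply (no_indecomposable_approx n n z nu0 W); auto.
  + unfold nu0; lra.
  + apply threshold_exponent with T; auto; [lia|]. unfold nu0; lra.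
  + destruct (what_set_weaken n z nu nu0) as [X0 [HX0 Happ]]; [unfold nu0; lra|exact Hnu|].
    exists X0. intros X HX. specialize (Happ X HX). apply approxP in Happ.
    destruct Happ as [p Hp]. exists p. split; [exact Hp|].
    intros q r Eqr _ Hq. destruct Hp as [Hp0 [Hpn _]].
    now apply evalR_dvd_ge with r n.
- apply (what_set_small_degree n m z nu W); auto; lra.
Qed.

(** * Numerical thresholds *)

(** The hypothesis is the last clause of [threshold] after solving for [W]; as [n] grows its sides
    tend to [e^(s-1)] and [2s - 1]. *)
Lemma threshold_intro (n : nat) (s : R) : 1 < s < INR n ->
  (1 + (s - 1) / (INR n - s)) ^ n <= 1 + (2 * INR n - s) * (s - 1) / (INR n - s) ->
  threshold n (2 * INR n - s) ((2 * INR n - s) * (INR n - 1) / (INR n - s)).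
Proof.
intros Hs Hle. set (T := 2 * INR n - s) in *. set (W := T * (INR n - 1) / (INR n - s)).
assert (HT : INR n < T) by (unfold T; lra).
assert (E1 : W / T = 1 + (s - 1) / (INR n - s)) by (unfold W; field; lra).
assert (E2 : W - T = T * (s - 1) / (INR n - s)) by (unfold W; field; lra).
assert (HWT : 0 < W - T).
{ rewrite E2. apply Rdiv_lt_0_compat; [apply Rmult_lt_0_compat; lra|lra]. }
split; [exact HT|]. split; [lra|]. split.
- unfold W. replace (T - INR n) with (INR n - s) by (unfold T; ring). field; lra.
- rewrite E1. rewrite E2. lra.
Qed.

(** [(1 + 1/k)^(k+1)] decreases with [k], so the value at 8 is the largest. Monotonicity is
    Bernoulli's inequality for the ratio [1 + 1/(x (x + 2))] of consecutive bases. *)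
Lemma euler_upper_bound (k : nat) : (8 <= k)%nat ->
  (1 + / INR k) ^ (S k) <= (9 / 8) ^ 9.
Proof.
intros Hk. induction Hk as [|k Hk IH].
- right. replace (INR 8) with 8 by (simpl; lra). replace (1 + / 8) with (9 / 8) by lra.
  reflexivity.
- assert (Hk0 : 8 <= INR k).
  { replace 8 with (INR 8) by (simpl; lra). now apply le_INR. }
  apply Rle_trans with (2 := IH).
  set (x := INR k) in *.
  assert (ES : INR (S k) = x + 1) by apply S_INR. rewrite ES.
  assert (Hx : 0 < / (x * (x + 2))) by (apply Rinv_0_lt_compat; nra).
  pose proof (poly (S (S k)) _ Hx) as Hb.
  assert (E2 : INR (S (S k)) = x + 2) by (rewrite S_INR, ES; ring). rewrite E2 in Hb.
  replace (1 + (x + 2) * / (x * (x + 2))) with (1 + / x) in Hb by (field; lra).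
  assert (Ey : 1 + / x = (1 + / (x + 1)) * (1 + / (x * (x + 2)))) by (field; nra).
  assert (H1 : 0 < / x) by (apply Rinv_0_lt_compat; lra).
  assert (H2 : 0 < / (x + 1)) by (apply Rinv_0_lt_compat; lra).
  assert (H3 : 0 < (1 + / (x + 1)) ^ S (S k)) by (apply pow_lt; lra).
  apply Rmult_le_reg_l with (1 + / x); [lra|].
  change ((1 + / x) * (1 + / x) ^ S k) with ((1 + / x) ^ S (S k)).
  rewrite Ey at 2. rewrite Rpow_mult_distr. rewrite Rmult_comm.
  apply Rmult_le_compat_l; lra.
Qed.

Lemma threshold_two (n : nat) : (10 <= n)%nat -> exists W, threshold n (2 * INR n - 2) W.
Proof.
intros Hn. eexists. apply threshold_intro.
- split; [lra|]. replace 2 with (INR 2) by (simpl; lra). apply lt_INR; lia.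
- destruct n as [|[|k]]; [lia|lia|].
  assert (Hk : (8 <= k)%nat) by lia.
  assert (Hk0 : 8 <= INR k).
  { replace 8 with (INR 8) by (simpl; lra). now apply le_INR. }
  replace (INR (S (S k))) with (INR k + 2) by (rewrite !S_INR; ring).
  replace (INR k + 2 - 2) with (INR k) by ring.
  replace ((2 - 1) / INR k) with (/ INR k) by (field; lra).
  replace (1 + (2 * (INR k + 2) - 2) * (2 - 1) / INR k) with (3 + 2 * / INR k) by (field; lra).
  pose proof (euler_upper_bound k Hk) as He.
  change ((1 + / INR k) ^ S (S k)) with ((1 + / INR k) * (1 + / INR k) ^ S k).
  (* With [28866/10000], slightly above [(9/8)^9], the claim is linear in [1/k] and holds for [1/k]
     up to about 0.1279, just beyond 1/8; hence the bound [n >= 10]. *)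
  assert (H1 : 0 < / INR k) by (apply Rinv_0_lt_compat; lra).
  assert (H2 : / INR k <= / 8) by (apply Rinv_le_contravar; lra).
  assert (H3 : (9 / 8) ^ 9 <= 28866 / 10000) by lra.
  apply Rle_trans with ((1 + / INR k) * (28866 / 10000)).
  + apply Rmult_le_compat_l; lra.
  + lra.
Qed.

(** Strict convexity of exp against its chord over [[0, D]], of slope 2. The tangent at [x] is
    compared with exp at [D] and at 0, and the two bounds are added with weights [x] and [D - x]. *)
Lemma exp_below_chord (D x : R) : exp D = 1 + 2 * D -> 0 < x < D -> exp x < 1 + 2 * x.
Proof.
intros HD Hx.
assert (H1 : exp x * (1 + (D - x)) < exp D).
{ replace D with (x + (D - x)) at 2 by ring. rewrite exp_plus.
  apply Rmult_lt_compat_l; [apply exp_pos|]. apply exp_ineq1; lra. }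
assert (H2 : exp x * (1 - x) < 1).
{ replace 1 with (exp x * exp (- x)) at 2 by (rewrite <- exp_plus, Rplus_opp_r; apply exp_0).
  apply Rmult_lt_compat_l; [apply exp_pos|]. apply exp_ineq1; lra. }
assert (H3 : x * (exp x * (1 + (D - x))) < x * exp D) by (apply Rmult_lt_compat_l; lra).
assert (H4 : (D - x) * (exp x * (1 - x)) < (D - x) * 1) by (apply Rmult_lt_compat_l; lra).
rewrite HD in H3.
apply Rmult_lt_reg_l with D; [lra|]. nra.
Qed.

Lemma threshold_eventually (D x : R) : exp D = 1 + 2 * D -> 0 < x < D ->
  exists n0, forall n, (n0 <= n)%nat -> exists W, threshold n (2 * INR n - (1 + x)) W.
Proof.
intros HD Hx. pose proof (exp_below_chord D x HD Hx) as Hlt.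
assert (Hln : x < ln (1 + 2 * x)).
{ rewrite <- (ln_exp x) at 1. apply ln_increasing; [apply exp_pos|exact Hlt]. }
set (g := ln (1 + 2 * x) - x).
(* For [n > N], [k = n - (1 + x)] satisfies [x (1 + x) / k <= g], so that
   [n x / k = x + x (1 + x) / k] stays below [ln (1 + 2 * x)]. *)
set (N := 1 + x + 1 + x * (1 + x) / g).
assert (Hg : 0 < g) by (unfold g; lra).
assert (Hq : 0 < x * (1 + x) / g) by (apply Rdiv_lt_0_compat; nra).
exists (Z.to_nat (up N)). intros n Hn.
assert (HN : N < INR n).
{ destruct (archimed N) as [Hup _]. apply Rlt_le_trans with (IZR (up N)); [lra|].
  rewrite INR_IZR_INZ. apply IZR_le. lia. }
eexists. apply threshold_intro.
- unfold N in HN. lra.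
- replace (1 + x - 1) with x by ring. set (k := INR n - (1 + x)).
  assert (Hk : 1 + x * (1 + x) / g < k) by (unfold k, N in *; lra).
  assert (Hxk : 0 < x / k) by (apply Rdiv_lt_0_compat; lra).
  apply Rle_trans with (1 + 2 * x).
  + apply Rle_trans with (exp (x / k) ^ n).
    { apply pow_incr. split; [lra|]. apply Rlt_le, exp_ineq1; lra. }
    rewrite <- (exp_ln (1 + 2 * x)) by lra.
    rewrite <- Rpower_pow by apply exp_pos. unfold Rpower. rewrite ln_exp.
    assert (Hle : INR n * (x / k) <= ln (1 + 2 * x)).
    { replace (INR n * (x / k)) with (x + x * (1 + x) / k)
        by (unfold k; field; unfold k in Hk; lra).
      assert (x * (1 + x) / k <= g); [|unfold g in *; lra].
      apply Rmult_le_reg_r with k; [lra|].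
      replace (x * (1 + x) / k * k) with (x * (1 + x)) by (field; lra).
      apply Rle_trans with (g * (x * (1 + x) / g)); [right; field; lra|].
      apply Rmult_le_compat_l; lra. }
    destruct Hle as [Hle|Hle]; [apply Rlt_le, exp_increasing, Hle|rewrite Hle; lra].
  + replace ((2 * INR n - (1 + x)) * x / k) with (2 * x + x * (1 + x) / k)
      by (unfold k; field; unfold k in Hk; lra).
    assert (0 < x * (1 + x) / k) by (apply Rdiv_lt_0_compat; nra). lra.
Qed.

(** Taking logarithms in the equation for [tau] gives [D = 1/tau - 1/2] with [D = ln (2/tau)], hence
    [e^D = 2/tau = 1 + 2 D]. The bound [D < 2] later guarantees [T >= 2n - 3]. *)
Lemma tau_exp (tau : R) : 0 < tau < 1 -> tau * exp (/ tau) = 2 * sqrt (exp 1) ->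
  exp (ln (2 / tau)) = 1 + 2 * ln (2 / tau) /\ 0 < ln (2 / tau) < 2.
Proof.
intros Ht He. set (D := ln (2 / tau)).
assert (H2 : 2 < 2 / tau).
{ apply Rmult_lt_reg_r with tau; [lra|]. unfold Rdiv.
  rewrite Rmult_assoc, Rinv_l by lra. lra. }
assert (HD0 : 0 < D).
{ unfold D. rewrite <- ln_1. apply ln_increasing; lra. }
assert (Hsq : sqrt (exp 1) = exp (/ 2)).
{ replace (exp 1) with (exp (/ 2) * exp (/ 2)) by (rewrite <- exp_plus; f_equal; lra).
  apply sqrt_square, Rlt_le, exp_pos. }
rewrite Hsq in He. apply (f_equal ln) in He.
rewrite !ln_mult, !ln_exp in He by (lra || apply exp_pos).
assert (HD : D = / tau - / 2).
{ unfold D, Rdiv. rewrite ln_mult, ln_Rinv by (try apply Rinv_0_lt_compat; lra). lra. }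
assert (Hexp : exp D = 1 + 2 * D).
{ unfold D at 1. rewrite exp_ln by lra. rewrite HD. field; lra. }
split; [exact Hexp|]. split; [exact HD0|].
(* If [D >= 2], then [e^D >= (11/2)(D - 1) > 1 + 2 D]. *)
apply Rnot_le_lt. intros HD2.
assert (He2 : 11 / 2 <= exp 2).
{ assert (Hq : 5 / 4 <= exp (/ 4)) by (pose proof (exp_ineq1 (/ 4)); lra).
  replace (exp 2) with (exp (/ 4) ^ 8).
  - apply Rle_trans with ((5 / 4) ^ 8); [lra|]. apply pow_incr; lra.
  - rewrite <- Rpower_pow by apply exp_pos. unfold Rpower. rewrite ln_exp.
    f_equal. simpl; lra. }
assert (HDe : exp D = exp 2 * exp (D - 2)) by (rewrite <- exp_plus; f_equal; ring).
assert (1 + (D - 2) <= exp (D - 2)) by apply exp_ineq1_le.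
assert ((11 / 2 * (1 + (D - 2))) <= exp 2 * exp (D - 2)) by (apply Rmult_le_compat; lra).
lra.
Qed.

(** * The exceptional case and the three final bounds *)

Lemma ER_le_antisym (a b : ER) : ER_le a b -> ER_le b a -> a = b.
Proof.
destruct a as [|a|], b as [|b|]; simpl; try tauto. intros. f_equal. lra.
Qed.

(** Suppose the bound fails, so [w_n > W]. A drop between [n] and [n - 1] above [W] is the case
    [m = n]. If [w_{n-2} > W], there is a drop at some [m <= n - 2], where
    [m + n - 1 <= 2n - 3 <= T]. Otherwise [w_{n-2} <= W < w_{n-1} = w_n], the excluded
    configuration. *)
Lemma what_le_threshold (n : nat) (z T W nu : R) (e0 e1 e2 : ER) : (2 <= n)%nat ->
  transcendental z -> SS_conj n z -> threshold n T W -> 2 * INR n - 3 <= T ->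
  w_ (n - 2) z e0 -> w_ (n - 1) z e1 -> w_ n z e2 -> ~ (ER_lt e0 e1 /\ e1 = e2) ->
  what_set n z nu -> nu <= T.
Proof.
intros Hn Hz HSS Hth HT3 [H0u H0l] [H1u H1l] [H2u H2l] Hexc Hnu.
apply Rnot_lt_le. intros HTnu.
pose proof Hth as [H1 [H2 [H3 H4]]]. pose proof (pos_INR n).
destruct (SS_conj_w_set_large n z T W nu) as [nu' [Hnu' Hw']]; auto; [lia|lra|].
destruct (classic (exists mu nu1, W < mu < nu1 /\ ~ w_set (n - 1) z mu /\ w_set n z nu1))
  as [[mu [nu1 [Hmu [Hno Hyes]]]]|Hsame].
- apply (Rle_not_lt T nu); [|exact HTnu].
  apply (what_le_of_degree_drop n n z T W mu nu1); auto; lia.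
- assert (Hdown : forall mu nu1, W < mu < nu1 -> w_set n z nu1 -> w_set (n - 1) z mu).
  { intros mu nu1 Hmu Hyes. apply NNPP. intros Hno. apply Hsame. exists mu, nu1. auto. }
  destruct (classic (exists nu2, W < nu2 /\ w_set (n - 2) z nu2)) as [[nu2 [Hnu2 Hw2]]|Hno2].
  + destruct (w_set_drop (n - 2) z W nu2) as [m [mu [nu1 [Hm [Hmu [Hno Hyes]]]]]];
      [lra|exact Hw2|].
    apply (Rle_not_lt T nu); [|exact HTnu].
    apply (what_le_of_degree_drop n m z T W mu nu1); auto; [lia|]. right.
    assert (INR m + 2 <= INR n).
    { replace 2 with (INR 2) by (simpl; lra). rewrite <- plus_INR. apply le_INR; lia. }
    lra.
  + apply Hexc.
    assert (He12 : ER_le e1 e2).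
    { apply H1l. intros x Hx. apply H2u. apply w_set_weaken with (n - 1)%nat x; auto; lia || lra. }
    assert (He21 : ER_le e2 e1).
    { apply H2l. intros x Hx. destruct e1 as [|r|]; simpl; auto.
      - apply (H1u ((W + nu') / 2)). apply Hdown with nu'; auto; lra.
      - apply Rnot_lt_le. intros Hrx.
        (* The descent [Hdown] works only above [W]; replacing [x] by [y] secures this even if [x]
           itself is small. *)
        set (y := Rmax x nu').
        assert (Hy : w_set n z y) by (unfold y, Rmax; now destruct (Rle_dec x nu')).
        pose proof (Rmax_l x nu'). pose proof (Rmax_r x nu').
        assert (Hmid : Rmax r W < y) by (apply Rmax_lub_lt; unfold y; lra).
        pose proof (Rmax_l r W). pose proof (Rmax_r r W).
        assert (Hc : ER_le (EFin ((Rmax r W + y) / 2)) (EFin r)).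
        { apply H1u. apply Hdown with y; auto; lra. }
        simpl in Hc. lra. }
    split; [|now apply ER_le_antisym].
    assert (He0 : ER_le e0 (EFin W)).
    { apply H0l. intros x Hx. apply Rnot_lt_le. intros Hlt. apply Hno2. now exists x. }
    assert (He1 : ER_le (EFin ((W + nu') / 2)) e1).
    { apply H1u. apply Hdown with nu'; auto; lra. }
    destruct e0 as [|a|], e1 as [|b|]; simpl in *; try contradiction;
      split; simpl; try discriminate; auto; try lra.
    intros E. injection E. lra.
Qed.

Theorem theorem3p1 (tau : R) (Htau : 0 < tau < 1)
  (Htau_eq : tau * exp (/ tau) = 2 * sqrt (exp 1)) :
  (forall (n : nat) (z : R), (2 <= n)%nat -> transcendental z -> SS_conj n z) ->
  let Delta := ln (2 / tau) + 1 in
  (* (i) *)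
  (forall eps : R, 0 < eps -> exists n0 : nat, forall (z : R) (n : nat),
     transcendental z -> (n0 <= n)%nat ->
     forall e, whatstar_ n z e -> ER_le e (EFin (2 * INR n - Delta + eps))) /\
  (* (ii) *)
  (forall eps : R, 0 < eps -> exists n0 : nat, forall (z : R) (n : nat),
     transcendental z -> (n0 <= n)%nat ->
     forall e0 e1 e2 e, w_ (n - 2) z e0 -> w_ (n - 1) z e1 -> w_ n z e2 ->
     what_ n z e ->
     ~ (ER_lt e0 e1 /\ e1 = e2) ->
     ER_le e (EFin (2 * INR n - Delta + eps))) /\
  (* (iii) *)
  (forall (z : R) (n : nat), transcendental z -> (10 <= n)%nat ->
     forall e, what_ n z e -> ER_le e (EFin (2 * INR n - 2))).
Proof.
intros HSS Delta. unfold Delta. clear Delta.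
destruct (tau_exp tau Htau Htau_eq) as [HD [HD0 HD2]].
set (D := ln (2 / tau)) in *.
assert (Hev : forall eps, 0 < eps -> exists n0, (2 <= n0)%nat /\
  forall n, (n0 <= n)%nat -> exists T W, threshold n T W /\
    2 * INR n - 3 <= T <= 2 * INR n - (D + 1) + eps).
(* Capping the loss at [D / 2] keeps [x] in [(0, D)], while [T = 2n - (1 + x)] exceeds
   [2n - (D + 1)] by at most [eps]. *)
{ intros eps Heps. set (x := D - Rmin eps (D / 2)).
  pose proof (Rmin_l eps (D / 2)). pose proof (Rmin_r eps (D / 2)).
  assert (0 < Rmin eps (D / 2)) by (apply Rmin_pos; lra).
  destruct (threshold_eventually D x HD) as [n0 Hn0]; [unfold x; lra|].
  exists (2 + n0)%nat. split; [lia|]. intros n Hn.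
  destruct (Hn0 n ltac:(lia)) as [W HW].
  exists (2 * INR n - (1 + x)), W. split; [exact HW|]. unfold x; lra. }
split; [|split].
- intros eps Heps. destruct (Hev eps Heps) as [n0 [Hn2 Hn0]]. exists n0.
  intros z n Hz Hn e He. destruct (Hn0 n Hn) as [T [W [Hth HT]]].
  apply (ER_sup_le _ _ _ He). intros nu Hnu.
  apply Rle_trans with T; [|lra].
  apply (whatstar_le_threshold n z T W nu); auto; [lia|]. apply HSS; auto; lia.
- intros eps Heps. destruct (Hev eps Heps) as [n0 [Hn2 Hn0]]. exists n0.
  intros z n Hz Hn e0 e1 e2 e He0 He1 He2 He Hexc.
  destruct (Hn0 n Hn) as [T [W [Hth HT]]].
  apply (ER_sup_le _ _ _ He). intros nu Hnu.
  apply Rle_trans with T; [|lra].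
  apply (what_le_threshold n z T W nu e0 e1 e2); auto; [lia| |lra].
  apply HSS; auto; lia.
- intros z n Hz Hn e He. apply (ER_sup_le _ _ _ He). intros nu Hnu.
  destruct (threshold_two n Hn) as [W Hth]. pose proof Hth as [H1 [H2 [H3 H4]]].
  pose proof (pos_INR n).
  apply Rnot_lt_le. intros HT.
  destruct (SS_conj_w_set_large n z (2 * INR n - 2) W nu) as [nu' [Hnu' Hw']];
    auto; [lia|apply HSS; auto; lia|lra|].
  destruct (w_set_drop n z W nu') as [m [mu [nu1 [Hm [Hmu [Hno Hyes]]]]]]; [lra|exact Hw'|].
  apply (Rle_not_lt (2 * INR n - 2) nu); [|exact HT].
  apply (what_le_of_degree_drop n m z _ W mu nu1); auto.
  (* Here [T = 2n - 2] accommodates [m = n - 1] too, so no exceptional case remains. *)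
  destruct (Nat.eq_dec m n) as [->|Hne]; [now left|right].
  assert (INR m + 1 <= INR n) by (rewrite <- S_INR; apply le_INR; lia). lra.
Qed.
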